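(* Let $j\in\mathbb N$ and let $\Psi_{\mathrm C}^j$ be the polynomial curvelet on $\mathbb S^{d-1}$ defined in the context. For $d=3$, $$\langle T^3(h(\gamma))\Psi_{\mathrm C}^j,\Psi_{\mathrm C}^j\rangle_{\mathbb S^2}=\sum_{n=0}^\infty\dim\mathcal H_n^3\left|\kappa\!\left(\tfrac{n}{2^{j-1}}\right)\right|^2\left(\cos^{2n}\tfrac\gamma2+\sin^{2n}\tfrac\gamma2\right),\qquad\gamma\in[0,2\pi),$$ where $h(\gamma)\in\mathbb R^{3\times3}$ is a positive rotation by $\gamma$ in the $(x_1,x_2)$-plane. If $d\ge4$, then for each $h\in SO(d-1)$ $$\langle T^d(h)\Psi_{\mathrm C}^j,\Psi_{\mathrm C}^j\rangle_{\mathbb S^{d-1}}=2\sum_{n=0}^\infty\dim\mathcal H_n^d\left|\kappa\!\left(\tfrac{n}{2^{j-1}}\right)\right|^2\sum_{\substack{m=0\\ m\text{ even}}}^n|c(d,n,m)|^2\,\frac{\Gamma(d-3)\,m!}{\Gamma(m+d-3)}\,C_m^{\frac{d-3}2}(\langle he^{d-1},e^{d-1}\rangle),$$ where $$c(d,n,m)=A_{(m,0,\dots,0)}^nA_{(n,\dots,n)}^n\,\frac{\sqrt\pi\,\Gamma(\frac d2)\binom nm\Gamma(m+d-3)(-\mathrm i)^m}{2^{m+d-4}(n+\frac{d-2}2)\Gamma(\frac{d-2}2)\Gamma(\frac{d-3}2)\Gamma(m+\frac{d-2}2)}.$$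
   Context: $\mathbb S^{d-1}$ ($d\ge3$) is the unit sphere of $\mathbb R^d$, $e^1,\dots,e^d$ the canonical basis, $\omega_{d-1}$ the rotation-invariant probability measure, $\langle f_1,f_2\rangle_{\mathbb S^{d-1}}=\int f_1\overline{f_2}\,d\omega_{d-1}$. For $g\in SO(d)$, $T^d(g)f=f(g^{-1}\cdot)$. $SO(d-1)$ is identified with $\{h\in SO(d):he^d=e^d\}$. $C_m^\lambda$ are the standard Gegenbauer polynomials, with $\int_{-1}^1|C_n^\lambda(t)|^2(1-t^2)^{\lambda-1/2}dt=\frac{\pi\Gamma(n+2\lambda)}{2^{2\lambda-1}n!(n+\lambda)\Gamma^2(\lambda)}$. For $n\in\mathbb N_0$ and integers $k=(k_1,\dots,k_{d-2})$ with $n=k_0\ge k_1\ge\dots\ge k_{d-3}\ge|k_{d-2}|$, $A_k^n>0$ is given by $$(A_k^n)^2=\frac{2^{(d-4)(d-2)}}{\Gamma(\frac d2)}\prod_{i=0}^{d-3}\frac{2^{2|k_{i+1}|-i}(k_i-|k_{i+1}|)!\,(2k_i+d-i-2)\,\Gamma^2(\frac{d-i-2}2+|k_{i+1}|)}{\sqrt\pi\,\Gamma(k_i+|k_{i+1}|+d-i-2)}.$$ Curvelets. Let $q\in\mathbb N$ and let $\phi\in C^q([0,\infty))$ be real-valued, non-increasing, with $\phi(t)=1$ for $t\in[0,1/2]$ and $\phi(t)=0$ for $t\ge1$. Put $\kappa(t)=\sqrt{\phi^2(t/2)-\phi^2(t)}$, so $\operatorname{supp}\kappa\subset[1/2,2]$.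 Let $\dim\mathcal H_n^d=\frac{(2n+d-2)(n+d-3)!}{(d-2)!\,n!}$. For $j\in\mathbb N$, $$\Psi_{\mathrm C}^j(x)=\sqrt2\sum_{n=0}^\infty\sqrt{\dim\mathcal H_n^d}\;\kappa\!\left(\tfrac{n}{2^{j-1}}\right)A_{(n,\dots,n)}^n\,\Re\{(x_d+\mathrm i x_{d-1})^n\},\qquad x\in\mathbb S^{d-1}.$$ *)

(* Defs.v *)
From HB Require Import structures.
From mathcomp Require Import all_boot all_order all_algebra.
From mathcomp Require Import complex.
From mathcomp Require Import all_classical all_reals all_analysis.

Set Implicit Arguments.
Unset Strict Implicit.
Unset Printing Implicit Defensive.

Import Order.TTheory GRing.Theory Num.Theory.
Import numFieldNormedType.Exports.

Local Open Scope classical_set_scope.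
Local Open Scope ring_scope.
Local Open Scope complex_scope.

(* Vectors of R^d are columns 'cV[R]_d. Basis vectors and coordinates are
   numbered from 1: coord x k is x_k for 1 <= k <= d. *)
Definition dot (R : realType) (d : nat) (x y : 'cV[R]_d) : R :=
  \sum_(i < d) x i 0 * y i 0.

Definition basis_vec (R : realType) (d k : nat) : 'cV[R]_d :=
  \col_(i < d) (i.+1 == k)%:R.

Definition coord (R : realType) (d : nat) (x : 'cV[R]_d) (k : nat) : R :=
  dot x (basis_vec R d k).

(* unit_sphere R d is S^(d-1). The norm `|x| of the library on 'cV[R]_d is the
   sup norm, whence the use of dot. *)
Definition unit_sphere (R : realType) (d : nat) : set 'cV[R]_d :=
  [set x | dot x x = 1].

Definition SO (R : realType) (d : nat) : set 'M[R]_d :=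
  [set g | g *m g^T = 1%:M /\ \det g = 1].

Definition borel_space (R : realType) (d : nat) :=
  g_sigma_algebraType (@open 'cV[R]_d).

(* A Borel probability measure on S^(d-1), seen as a measure on R^d carried by
   S^(d-1), which is rotation invariant. For d >= 2 there is exactly one. *)
Definition rotation_invariant (R : realType) (d : nat)
    (omega : probability (borel_space R d) R) : Prop :=
  omega (@unit_sphere R d) = 1%E /\
  forall (g : 'M[R]_d) (A : set (borel_space R d)),
    @SO R d g -> measurable A ->
    omega ((fun x : 'cV[R]_d => (g *m x : 'cV[R]_d)) @^-1` A) = omega A.

Definition inner (R : realType) (d : nat)
    (omega : probability (borel_space R d) R) (f1 f2 : 'cV[R]_d -> R[i]) : R[i] :=
  let F (x : borel_space R d) : R[i] := f1 x * (f2 x)^*%C in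
  (\int[omega]_(x in @unit_sphere R d) complex.Re (F x))%R +i*
  (\int[omega]_(x in @unit_sphere R d) complex.Im (F x))%R.

Definition rotate (R : realType) (d : nat) (g : 'M[R]_d)
    (f : 'cV[R]_d -> R[i]) : 'cV[R]_d -> R[i] :=
  fun x => f (invmx g *m x).

Definition rotation12 (R : realType) (gamma : R) : 'M[R]_3 :=
  \matrix_(i < 3, j < 3)
    nth 0 (nth [::] [:: [:: cos gamma; - sin gamma; 0];
                        [:: sin gamma;   cos gamma; 0];
                        [:: 0;           0;         1]] i) j.

(* Euler's integral; only meaningful for x > 0. *)
Definition Gamma (R : realType) (x : R) : R :=
  (\int[lebesgue_measure]_(t in `]0, +oo[) (t `^ (x - 1) * expR (- t)))%R.

(* The explicit formula
     C_m^l(t) = sum_(k <= m/2)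
                  (-1)^k (l)_(m-k) / (k! (m-2k)!) (2t)^(m-2k),
   with (l)_r = l (l+1) ... (l+r-1). *)
Definition gegenbauer (R : realType) (l : R) (m : nat) (t : R) : R :=
  \sum_(k < m./2.+1)
    (-1) ^+ k * (\prod_(i < m - k) (l + i%:R)) / (k`! * (m - k.*2)`!)%:R
      * (2 * t) ^+ (m - k.*2).

(* A_k^n, for k = [:: k_1; ...; k_(d-2)]. Since k_0 >= ... >= k_(d-3) >= 0,
   `|k_i| equals k_i wherever k_i occurs below without absolute value. *)
Definition Acoef (R : realType) (d n : nat) (k : seq int) : R :=
  let K (i : nat) : nat := absz (nth 0 (n%:Z :: k) i) in
  Num.sqrt
    (2 ^ ((d%:Z - 4) * (d%:Z - 2)) / Gamma (d%:R / 2) *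
     \prod_(i < d - 2)
       (2 ^ (2 * (K i.+1)%:Z - i%:Z) * (K i - K i.+1)`!%:R *
        (2 * K i + d - i - 2)%:R *
        Gamma ((d - i - 2)%:R / 2 + (K i.+1)%:R) ^+ 2 /
        (Num.sqrt pi * Gamma (K i + K i.+1 + d - i - 2)%:R))).

Definition dimH (R : realType) (d n : nat) : R :=
  ((2 * n + d - 2) * (n + d - 3)`!)%:R / ((d - 2)`! * n`!)%:R.

(* f is of class C^q on [0, +oo[, with derivatives D 1, ..., D q relative to
   [0, +oo[ (one-sided at 0); the values of f on ]-oo, 0[ are irrelevant. *)
Definition Cq_half_line (R : realType) (q : nat) (f : R -> R) : Prop :=
  exists D : nat -> R -> R,
    [/\ (forall x, 0 <= x -> D 0%N x = f x),
        (forall (i : nat) (x : R), (i < q)%N -> 0 <= x ->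
           (D i y - D i x) / (y - x)
             @[y --> within [set y | 0 <= y /\ y != x] (nbhs x)]
             --> D i.+1 x) &
        (forall i : nat, (i <= q)%N ->
           {within [set x : R | 0 <= x], continuous (D i)})].

Definition curvelet_cutoff (R : realType) (q : nat) (phi : R -> R) : Prop :=
  [/\ Cq_half_line q phi,
      (forall s t, 0 <= s -> s <= t -> phi t <= phi s),
      (forall t, 0 <= t <= 1 / 2 -> phi t = 1) &
      (forall t, 1 <= t -> phi t = 0)].

Definition kappa (R : realType) (phi : R -> R) (t : R) : R :=
  Num.sqrt (phi (t / 2) ^+ 2 - phi t ^+ 2).

Lemma kappa_eq0 (R : realType) (q : nat) (phi : R -> R) (t : R) :
  curvelet_cutoff q phi -> 2 <= t -> kappa phi t = 0.
Proof.
move=> [_ _ _ phi0] t2; rewrite /kappa !phi0 ?subrr ?sqrtr0 //.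
  by rewrite (le_trans _ t2) // ler1n.
by rewrite ler_pdivlMr ?mul1r.
Qed.

(* By kappa_eq0, the series has finitely many nonzero terms. *)
Definition curvelet (R : realType) (d : nat) (phi : R -> R) (j : nat)
    (x : 'cV[R]_d) : R[i] :=
  (Num.sqrt 2 *
   limn (series (fun n : nat =>
      Num.sqrt (dimH R d n) * kappa phi (n%:R / 2 ^+ j.-1) *
      Acoef R d n (nseq (d - 2) n%:Z) *
      complex.Re ((coord x d +i* coord x d.-1) ^+ n))))%:C.

(* Only used for d >= 4. *)
Definition ccoef (R : realType) (d n m : nat) : R[i] :=
  (Acoef R d n (m%:Z :: nseq (d - 3) 0) * Acoef R d n (nseq (d - 2) n%:Z))%:C *
  ((Num.sqrt pi * Gamma (d%:R / 2) * 'C(n, m)%:R * Gamma (m + d - 3)%:R)%:C *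
     (- 'i) ^+ m /
   (2 ^+ (m + d - 4) * (n%:R + (d - 2)%:R / 2) * Gamma ((d - 2)%:R / 2) *
    Gamma ((d - 3)%:R / 2) * Gamma (m%:R + (d - 2)%:R / 2))%:C).

(* Main.v *)
Require Import Defs.
From HB Require Import structures.
From mathcomp Require Import all_boot all_order all_algebra.
From mathcomp Require Import complex.
From mathcomp Require Import all_classical all_reals all_analysis.
From mathcomp Require Import measurable_realfun.
From mathcomp Require Import ring zify.

Import Order.TTheory GRing.Theory Num.Theory.
Import numFieldNormedType.Exports.

Local Open Scope classical_set_scope.
Local Open Scope ring_scope.
Local Open Scope complex_scope.

(** Let a = e^d, b = e^(d-1), and let z = x_d + i x_(d-1) be the complex coordinate
    of the plane of a and b.  A curvelet is a finite combination of the functions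
    Re (z^n).  A rotation h with h a = a sends b to t b + w with w orthogonal to
    a and b, so the rotated coordinate is

      al z + be conj(z) + i <x, w>,   al = (1 + t)/2,  be = (1 - t)/2.

    Rotating the plane of a and b by an angle multiplies z by a phase and preserves
    the mean over the sphere; hence the mean of z^p conj(z)^q <x, w>^k vanishes
    unless p = q ([mean_charge]).  Expanding powers of the rotated coordinate, this
    conservation law kills every correlation between different degrees, and in
    degree n it leaves half of (al^n + be^n) times the mean of |z|^(2n)
    ([mean_Re_lt], [mean_Re_eq], [correlation]).

    The same law computes that mean ([power_normE]).  Since x_d is the real part of
    z, it expresses the means of x_d^(2n) and x_d^(2n) x_k^2 through the means of
    powers of |z|; summing over k and using sum_k x_k^2 = 1 gives a recursion, whose
    solution is n! Gamma(d/2) / Gamma(n + d/2).  The squared constant A_(n,...,n) is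
    the inverse of this number: by the duplication formula at half-integers, the
    product defining it telescopes ([Acoef_nseq_sqr]).  Therefore the
    autocorrelation is

      sum_n dim H_n kappa^2 (((1 + t)/2)^n + ((1 - t)/2)^n)

    in every dimension d >= 3 ([curvelet_autocorrelation]).

    For d = 3 one has t = cos(gamma), and the half-angle formulas conclude.  For
    d >= 4 it remains to expand ((1 + t)/2)^n in Gegenbauer polynomials of parameter
    (d - 3)/2, which the three-term recurrence does by induction on n
    ([gegenbauer_expansion]), and to recognise its coefficients in the numbers
    |c(d,n,m)|^2 ([weight_ccoef]).  Adding the value at -t retains the even m. *)

(** * Special values of the Gamma function *)

Section EulerGamma.
Variable R : realType.
Implicit Types (x t : R) (f : R -> R).
Notation mu := (@lebesgue_measure R).

Definition gamma_integrand x t : R := t `^ (x - 1) * expR (- t).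

Lemma gamma_integrand_ge0 x t : 0 <= gamma_integrand x t.
Proof. by rewrite mulr_ge0 ?powR_ge0 ?expR_ge0. Qed.

(** Compact intervals filling the open half line; squaring maps
    [exhaustion 1 n] onto [exhaustion 2 n], which is what the substitution
    t = u^2 in the integral for Gamma(1/2) needs. *)
Definition exhaustion (k n : nat) : set R :=
  `[n.+2%:R^-1 ^+ k, n.+2%:R ^+ k].

Lemma exhaustion_pos k n t : exhaustion k n t -> 0 < t.
Proof.
rewrite /exhaustion /= in_itv/= => /andP[+ _]; apply: lt_le_trans.
by rewrite exprn_gt0// invr_gt0.
Qed.

Lemma bigcup_exhaustion k : (0 < k)%N ->
  \bigcup_n exhaustion k n = `]0, +oo[%classic.
Proof.
move=> k0; apply/seteqP; split=> t.
  by move=> [n _ /exhaustion_pos]; rewrite /= in_itv/= andbT.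
rewrite /= in_itv/= andbT => t0.
have [n /andP[tn tni]] : exists n, (t <= n.+2%:R) && (t^-1 <= n.+2%:R).
  pose M := Num.max t t^-1.
  have M0 : 0 <= M by rewrite le_max ltW.
  exists (Num.trunc M).
  have MM : M <= (Num.trunc M).+2%:R.
    have := truncnS_gt M; move/ltW/le_trans; apply.
    by rewrite ler_nat.
  by rewrite !(le_trans _ MM)// le_max lexx ?orbT.
have n1 : 1 <= n.+2%:R :> R by rewrite ler1n.
have nk : n.+2%:R <= n.+2%:R ^+ k :> R by apply: ler_eXnr.
exists n => //; rewrite /exhaustion /= in_itv/= (le_trans tn)// andbT.
rewrite exprVn -[leRHS]invrK lef_pV2 ?posrE ?exprn_gt0 ?invr_gt0//.
exact: le_trans nk.
Qed.

(** Monotone convergence: the endpoint singularities of the Gamma integrand are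
    never met, because calculus takes place on the compact intervals only. *)
Lemma cvg_integral_exhaustion k f : (0 < k)%N ->
  (forall t, 0 < t -> 0 <= f t) -> {in `]0, +oo[, continuous f} ->
  (\int[mu]_(t in exhaustion k n) (f t)%:E @[n --> \oo] -->
   \int[mu]_(t in `]0%R, +oo[) (f t)%:E)%E.
Proof.
move=> k0 f0 cf; rewrite -(bigcup_exhaustion k k0).
have cf' n : {within exhaustion k n, continuous f}.
  apply: continuous_in_subspaceT => t /set_mem/exhaustion_pos t0.
  by apply: cf; rewrite in_itv/= t0.
apply: ge0_nondecreasing_set_cvg_integral.
- move=> m n mn; rewrite subsetEset => t /=; rewrite /exhaustion /= !in_itv/=.
  move=> /andP[lt tu]; apply/andP; split.
    apply: le_trans lt; rewrite lerXn2r ?nnegrE ?invr_ge0//.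
    by rewrite lef_pV2 ?posrE// ler_nat !ltnS.
  by apply: le_trans tu _; rewrite lerXn2r ?nnegrE// ler_nat !ltnS.
- by move=> n; exact: measurable_itv.
- move=> n; apply/measurable_EFinP.
  by apply: subspace_continuous_measurable_fun => //; exact: measurable_itv.
- by move=> n t /exhaustion_pos t0; rewrite lee_fin f0.
Qed.

Lemma exhaustion_lt k n : (0 < k)%N ->
  n.+2%:R^-1 ^+ k < n.+2%:R ^+ k :> R.
Proof.
case: k => // k _.
rewrite exprVn (@lt_trans _ _ 1)//.
  by rewrite invf_lt1 ?exprn_gt0// exprn_egt1// ltr1n.
by rewrite exprn_egt1// ltr1n.
Qed.

Lemma is_derive_gamma_integrand x t : 0 < t ->
  is_derive t 1 (fun s => s `^ x * expR (- s))
    (x * gamma_integrand x t - t `^ x * expR (- t)).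
Proof.
move=> t0.
have h1 := is_derive1_powR x t0.
have h2 : is_derive t 1 (fun s : R => expR (- s)) (- expR (- t)).
  have : is_derive t 1 (@expR R \o -%R) (expR (- t) * - 1).
    exact: is_derive1_comp.
  by rewrite mulrN1.
apply: is_derive_eq.
rewrite /gamma_integrand /GRing.scale/=; ring.
Qed.

Lemma continuous_gamma_integrand x : {in `]0, +oo[, continuous (gamma_integrand x)}.
Proof.
move=> t; rewrite in_itv/= andbT => t0.
have [+ _] := is_derive_gamma_integrand (x - 1) t t0.
by move/derivable1_diffP/differentiable_continuous.
Qed.

Lemma cvg_powR_seq0 x (u : nat -> R) : 0 < x -> (forall n, 0 < u n) ->
  u n @[n --> \oo] --> 0 -> u n `^ x @[n --> \oo] --> 0.
Proof.
move=> x0 u0 cu; have /cvg_at_rightP/(_ u) := powR_cvg0 x0.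
by apply; split.
Qed.

Lemma cvg_inv_sqr_natSS : n.+2%:R^-1 ^+ 2 @[n --> \oo] --> (0 : R).
Proof.
have h : n.+2%:R^-1 @[n --> \oo] --> (0 : R).
  rewrite (cvg_shiftS (fun n => n.+1%:R^-1 : R)); exact: cvg_harmonic.
have := cvgM h h; rewrite mulr0.
rewrite (_ : _ \* _ = fun n => n.+2%:R^-1 ^+ 2); first exact.
by apply/funext => n; rewrite expr2.
Qed.

Lemma cvg_gamma_boundary0 x : 0 < x ->
  let a (n : nat) : R := n.+2%:R^-1 ^+ 2 in
  a n `^ x * expR (- a n) @[n --> \oo] --> (0 : R).
Proof.
move=> x0 a.
have a0 n : 0 < a n by rewrite exprn_gt0 ?invr_gt0.
apply: (@squeeze_cvgr _ _ _ _ (fun=> 0) (fun n => a n `^ x)).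
- near=> n; rewrite mulr_ge0 ?powR_ge0 ?expR_ge0//=.
  by rewrite ler_piMr ?powR_ge0// expR_le1 oppr_le0 ltW.
- exact: cvg_cst.
- by apply: cvg_powR_seq0 => //; exact: cvg_inv_sqr_natSS.
Unshelve. all: end_near. Qed.

(** Write exp(-t) as the x-th power of exp(-t/x), and bound exp(-t/x) by using
    y <= exp(y) twice with y = t/(2x). *)
Lemma gamma_tail_le x t : 0 < x -> 0 < t ->
  t `^ x * expR (- t) <= (4 * x ^+ 2 * t^-1) `^ x.
Proof.
move=> x0 t0.
have -> : expR (- t) = expR (- (t / x)) `^ x.
  by rewrite -expRM; congr expR; rewrite mulNr mulfVK ?gt_eqF.
rewrite -powRM ?expR_ge0 ?(ltW t0)//.
have y0 : 0 < t / (2 * x) by rewrite divr_gt0// mulr_gt0.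
apply: ge0_ler_powR; rewrite ?nnegrE ?(ltW x0)//.
- by rewrite mulr_ge0 ?expR_ge0 ?ltW.
- by rewrite !mulr_ge0 ?sqr_ge0 ?invr_ge0 ?ltW.
have -> : - (t / x) = - (t / (2 * x)) + - (t / (2 * x)) by field; rewrite gt_eqF.
rewrite expRD expRN.
set y := t / (2 * x) in y0 *.
have -> : 4 * x ^+ 2 * t^-1 = t * (y^-1 * y^-1).
  by rewrite /y; field; rewrite !gt_eqF.
have ey : (expR y)^-1 <= y^-1.
  rewrite lef_pV2 ?posrE ?expR_gt0//.
  by apply: le_trans (expR_ge1Dx y); rewrite lerDr.
by rewrite ler_pM2l// ler_pM// invr_ge0 expR_ge0.
Qed.

Lemma cvg_gamma_boundaryy x : 0 < x ->
  let b (n : nat) : R := n.+2%:R ^+ 2 in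
  b n `^ x * expR (- b n) @[n --> \oo] --> (0 : R).
Proof.
move=> x0 b.
have b0 n : 0 < b n by rewrite exprn_gt0.
apply: (@squeeze_cvgr _ _ _ _ (fun=> 0) (fun n => (4 * x ^+ 2 * (b n)^-1) `^ x)).
- near=> n; rewrite mulr_ge0 ?powR_ge0 ?expR_ge0//=.
  exact: gamma_tail_le.
- exact: cvg_cst.
- apply: cvg_powR_seq0 => //.
    by move=> n; rewrite mulr_gt0 ?invr_gt0// mulr_gt0// exprn_gt0.
  have h : (b n)^-1 @[n --> \oo] --> (0 : R).
    rewrite (_ : (fun n => (b n)^-1) = (fun n => n.+2%:R^-1 ^+ 2)).
      exact: cvg_inv_sqr_natSS.
    by apply/funext => n; rewrite /b exprVn.
  have c : 4 * x ^+ 2 @[_ --> \oo] --> 4 * x ^+ 2 by exact: cvg_cst.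
  by have := cvgM c h; rewrite mulr0; exact.
Unshelve. all: end_near. Qed.

Lemma continuous_itv_cc f (a b : R) : 0 < a -> {in `]0, +oo[, continuous f} ->
  {within `[a, b], continuous f}.
Proof.
move=> a0 cf; apply: continuous_in_subspaceT => t /set_mem/=.
rewrite in_itv/= => /andP[a_t _]; apply: cf.
by rewrite in_itv/= andbT (lt_le_trans a0).
Qed.

Lemma is_derive_pos_LRcontinuous f (df : R -> R) (a b : R) : 0 < a -> a < b ->
  (forall t, 0 < t -> is_derive t 1 f (df t)) ->
  derivable_oo_LRcontinuous f a b /\ {in `]a, b[, (f^`())%classic =1 df}.
Proof.
move=> a0 ab fd.
have cf t : 0 < t -> {for t, continuous f}.
  move=> t0; have [+ _] := fd t t0.
  by move/derivable1_diffP/differentiable_continuous.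
split; last first.
  move=> t; rewrite in_itv/= => /andP[a_t _].
  by have [_ <-] := fd t (lt_trans a0 a_t); rewrite derive1E.
split.
- move=> t; rewrite in_itv/= => /andP[a_t _].
  by have [] := fd t (lt_trans a0 a_t).
- by apply: cvg_at_right_filter; apply: cf.
- by apply: cvg_at_left_filter; apply: cf; exact: lt_trans ab.
Qed.

(** Integration by parts on [exhaustion 2 n]; the boundary terms tend to 0.  The
    identity is one of extended reals, so that convergence of the integrals is
    never an issue. *)
Lemma integral_gammaS x : 0 < x ->
  (\int[mu]_(t in `]0%R, +oo[) (gamma_integrand (x + 1) t)%:E =
   x%:E * \int[mu]_(t in `]0%R, +oo[) (gamma_integrand x t)%:E)%E.
Proof.
move=> x0.
have giS t : gamma_integrand (x + 1) t = t `^ x * expR (- t).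
  by rewrite /gamma_integrand addrK.
have cI := @cvg_integral_exhaustion 2 (gamma_integrand x) isT
   (fun t _ => gamma_integrand_ge0 x t) (@continuous_gamma_integrand x).
have cJ := @cvg_integral_exhaustion 2 (gamma_integrand (x + 1)) isT
   (fun t _ => gamma_integrand_ge0 _ t) (@continuous_gamma_integrand _).
have cB : (((n.+2%:R ^+ 2) `^ x * expR (- n.+2%:R ^+ 2) -
    (n.+2%:R^-1 ^+ 2) `^ x * expR (- n.+2%:R^-1 ^+ 2))%:E : \bar R)
    @[n --> \oo] --> 0%E.
  apply: cvg_EFin; first by near=> n.
  have := cvgB (cvg_gamma_boundaryy x x0) (cvg_gamma_boundary0 x x0).
  by rewrite subr0; exact.
have fJB : (\int[mu]_(t in `]0%R, +oo[) (gamma_integrand (x + 1) t)%:E +? 0)%E.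
  by rewrite fin_num_adde_defl.
have := cvgeD fJB cJ cB; rewrite adde0 => /(_ (eventually_filter)) cJB.
have {}cI := @cvgeZl _ _ _ _ _ x%:E isT cI.
move: cJB; set u := (fun n => _) => cJB.
suff uE : u = (fun n => x%:E * \int[mu]_(t in exhaustion 2 n) (gamma_integrand x t)%:E)%E.
  by rewrite uE in cJB; exact: (cvg_unique _ cJB cI).
apply/funext => n; rewrite /u {u cJB}.
set a : R := n.+2%:R^-1 ^+ 2; set b : R := n.+2%:R ^+ 2.
have ab : a < b by exact: exhaustion_lt.
have a0 : 0 < a by rewrite exprn_gt0 ?invr_gt0.
have [dF F'] :=
  is_derive_pos_LRcontinuous _ _ _ _ a0 ab (is_derive_gamma_integrand x).
have cg y := continuous_itv_cc _ a b a0 (continuous_gamma_integrand y).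
have cd : {within `[a, b],
    continuous (fun t => x * gamma_integrand x t - t `^ x * expR (- t))}.
  rewrite (_ : (fun t => _) = fun t => x * gamma_integrand x t - gamma_integrand (x + 1) t).
    apply: continuous_itv_cc => // t t0.
    apply: cvgB; last exact: continuous_gamma_integrand.
    by apply: cvgM; [exact: cvg_cst|exact: continuous_gamma_integrand].
  by apply/funext => t; rewrite giS.
have ii f : {within `[a, b], continuous f} -> mu.-integrable `[a, b] (EFin \o f).
  by move=> cf; apply: continuous_compact_integrable => //; exact: segment_compact.
rewrite EFinB -(continuous_FTC2 ab cd dF F').
rewrite /exhaustion -/a -/b -integralZl//=; last exact: ii.
rewrite -integralD//=; [|exact: ii|exact: ii].
by apply: eq_integral => t _; rewrite -EFinM -EFinD giS addrC subrK.
Unshelve. all: end_near. Qed.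

Lemma GammaS x : 0 < x -> Gamma (x + 1) = x * Gamma x.
Proof.
move=> x0; rewrite /Gamma /Rintegral.
rewrite [X in fine X](integral_gammaS x x0).
rewrite -/(gamma_integrand x).
set I := (\int[_]_(_ in _) _)%E.
have : (0 <= I)%E by apply: integral_ge0 => t _; rewrite lee_fin gamma_integrand_ge0.
case: I => [r| |] //= _.
by rewrite gt0_muley ?lte_fin//= mulr0.
Qed.

Lemma Gamma1 : Gamma (1 : R) = 1.
Proof.
rewrite /Gamma /Rintegral.
have -> : (\int[mu]_(t in `]0%R, +oo[) (t `^ (1 - 1) * expR (- t))%:E =
          \int[mu]_(t in `[0%R, +oo[) (expR (- t))%:E)%E.
  rewrite -integral_itv_obnd_cbnd; last first.
    by apply/measurable_EFinP/measurable_funTS; apply: measurableT_comp.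
  by apply: eq_integral => t _; rewrite subrr powRr0 mul1r.
have dF t : is_derive t 1 (fun s : R => - expR (- s)) (expR (- t)).
  have : is_derive t 1 (@expR R \o -%R) (expR (- t) * - 1).
    exact: is_derive1_comp.
  by move=> /is_deriveN; rewrite mulrN1 opprK.
have cF : continuous (fun s : R => - expR (- s)).
  move=> t; have [+ _] := dF t.
  by move/derivable1_diffP/differentiable_continuous.
rewrite (@ge0_continuous_FTC2y _ (fun t => expR (- t)) (fun s => - expR (- s)) 0 0).
- by rewrite oppr0 expR0 sub0e /= opprK.
- by move=> t _; exact: expR_ge0.
- apply: continuous_subspaceT => t.
  apply: (@continuous_comp _ _ _ -%R expR); first exact: opp_continuous.
  exact: continuous_expR.
- by rewrite -oppr0; apply: cvgN; exact: cvgr_expR.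
- by move=> t _; have [] := dF t.
- by apply: cvg_at_right_filter; exact: cF.
- by move=> t _; have [_ <-] := dF t; rewrite derive1E.
Qed.

(** The substitution t = u^2 turns the integral into the Gaussian one.  It is made
    on the compact intervals, where the derivative 2u is bounded. *)
Lemma Gamma_half : Gamma (2^-1 : R) = Num.sqrt pi.
Proof.
have cI := @cvg_integral_exhaustion 2 (gamma_integrand 2^-1) isT
   (fun t _ => gamma_integrand_ge0 _ t) (@continuous_gamma_integrand _).
have cont : continuous (fun t : R => 2 * gauss_fun t).
  by move=> t; apply: cvgM; [exact: cvg_cst | exact: continuous_gauss_fun].
have cG := @cvg_integral_exhaustion 1 (fun t => 2 * gauss_fun t) isT
  (fun t _ => mulr_ge0 (ler0n R 2) (gauss_fun_ge0 t)) (fun t _ => cont t).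
suff : (\int[mu]_(t in `]0%R, +oo[) (gamma_integrand 2^-1 t)%:E = (Num.sqrt pi)%:E)%E.
  by rewrite /Gamma /Rintegral => ->.
transitivity (\int[mu]_(t in `]0%R, +oo[) (2 * gauss_fun t)%:E)%E; last first.
  under eq_integral do rewrite EFinM.
  rewrite ge0_integralZl//=.
  - rewrite integral_itv_obnd_cbnd; last first.
      by apply/measurable_EFinP/measurable_funTS; exact: measurable_gauss_fun.
    by rewrite integral0y_gauss -EFinM mulrC divfK.
  - by apply/measurable_EFinP/measurable_funTS; exact: measurable_gauss_fun.
  - by move=> t _; rewrite lee_fin gauss_fun_ge0.
move: cI; set u := (fun n => _) => cI.
suff uE : u = (fun n => \int[mu]_(t in exhaustion 1 n) (2 * gauss_fun t)%:E)%E.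
  by rewrite uE in cI; exact: (cvg_unique _ cI cG).
apply/funext => n; rewrite /u {u cI}.
rewrite /exhaustion !expr1.
set a : R := n.+2%:R^-1; set b : R := n.+2%:R.
have ab : a < b by have := @exhaustion_lt 1 n isT; rewrite !expr1.
have a0 : 0 < a by rewrite invr_gt0.
have dsq t : is_derive t 1 (fun u : R => u ^+ 2) (2 * t).
  by apply: is_derive_eq; rewrite /GRing.scale/=; ring.
have dE : (fun u : R => u ^+ 2)^`()%classic = (fun t => 2 * t).
  by apply/funext => t; rewrite derive1E; have [_ ->] := dsq t.
have [dF _] := is_derive_pos_LRcontinuous _ _ _ _ a0 ab (fun t _ => dsq t).
have c2 t : {for t, continuous (fun t : R => 2 * t)}.
  by apply: cvgM; [exact: cvg_cst|exact: cvg_id].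
rewrite (@integration_by_substitution_increasing _ (fun u => u ^+ 2) (gamma_integrand 2^-1)).
- apply: eq_integral => t; rewrite inE/= in_itv/= => /andP[a_t _].
  have t0 : 0 < t by exact: lt_le_trans a_t.
  rewrite dE mulrfctE /= /gamma_integrand /gauss_fun.
  have -> : 2^-1 - 1 = - 2^-1 :> R by field.
  rewrite powRN powR12_sqrt ?sqr_ge0// sqrtr_sqr ger0_norm ?(ltW t0)//.
  by congr EFin; field; rewrite gt_eqF.
- exact: ltW.
- move=> s t; rewrite !in_itv/= => /andP[sa _] /andP[ta _] st.
  by rewrite ltrXn2r ?nnegrE ?(ltW (lt_le_trans a0 _)).
- by move=> t _; rewrite dE; exact: c2.
- by rewrite dE; apply/cvg_ex; exists (2 * a); apply: cvg_at_right_filter; exact: c2.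
- by rewrite dE; apply/cvg_ex; exists (2 * b); apply: cvg_at_left_filter; exact: c2.
- exact: dF.
- apply: continuous_itv_cc; first by rewrite exprn_gt0.
  exact: continuous_gamma_integrand.
Unshelve. all: end_near. Qed.

End EulerGamma.

(** * Gegenbauer polynomials *)

Definition rising (R : realType) (x : R) n := \prod_(i < n) (x + i%:R).

Section Gegenbauer.
Variable R : realType.
Implicit Types (l t : R).

(** Extended by 0 beyond the last summand, so that the sums for different degrees
    can be taken over a common range. *)
Definition gegenbauer_term l t m k : R :=
  if (k.*2 <= m)%N then
    (-1) ^+ k * rising R l (m - k) / (k`! * (m - k.*2)`!)%:R * (2 * t) ^+ (m - k.*2)
  else 0.

Lemma gegenbauer_termE l t m N : (m./2 < N)%N ->
  gegenbauer l m t = \sum_(k < N) gegenbauer_term l t m k.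
Proof.
move=> mN; rewrite /gegenbauer -(big_mkord xpredT (gegenbauer_term l t m)).
rewrite (big_cat_nat _ mN)//= [X in _ + X]big1_seq ?addr0; last first.
  move=> k /andP[_]; rewrite mem_index_iota => /andP[mk _]; rewrite /gegenbauer_term.
  rewrite ifF//; apply/negbTE; rewrite -ltnNge; lia.
rewrite big_mkord; apply: eq_bigr => k _; rewrite /gegenbauer_term ifT//.
by have := ltn_ord k; lia.
Qed.

Lemma gegenbauer0 l t : gegenbauer l 0 t = 1.
Proof.
rewrite (gegenbauer_termE l t 0 1)// big_ord1 /gegenbauer_term/= /rising big_ord0.
rewrite fact0 muln1 !expr0 !mulr1; exact: divr1.
Qed.

Lemma gegenbauer1 l t : gegenbauer l 1 t = 2 * l * t.
Proof.
rewrite (gegenbauer_termE l t 1 1)// big_ord1 /gegenbauer_term/= /rising big_ord1.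
rewrite fact0 mul1n expr0 expr1 -[1`!%:R]/1 divr1 addr0 mul1r; ring.
Qed.

Lemma risingS l n : rising R l n.+1 = rising R l n * (l + n%:R).
Proof. by rewrite /rising big_ord_recr. Qed.

Lemma gegenbauer_term_rec0 l t m :
  m.+2%:R * gegenbauer_term l t m.+2 0 =
  2 * (m.+1%:R + l) * t * gegenbauer_term l t m.+1 0.
Proof.
rewrite /gegenbauer_term !double0 !leq0n !subn0 fact0 !mul1n (risingS l m.+1) factS natrM.
have h1 : m.+1`!%:R != 0 :> R by rewrite pnatr_eq0 -lt0n fact_gt0.
have h2 : m.+2%:R != 0 :> R by rewrite pnatr_eq0.
rewrite (exprS _ m.+1); move: (_ ^+ m.+1) (rising _ _ _) (_`!%:R) h1 m.+2%:R h2 m.+1%:R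
  => p r f f0 a a0 b.
by field; rewrite f0 a0.
Qed.

Lemma gegenbauer_term_recS l t m k :
  m.+2%:R * gegenbauer_term l t m.+2 k.+1 =
  2 * (m.+1%:R + l) * t * gegenbauer_term l t m.+1 k.+1
  - (m%:R + 2 * l) * gegenbauer_term l t m k.
Proof.
rewrite /gegenbauer_term doubleS (_ : (k.*2.+2 <= m.+2)%N = (k.*2 <= m)%N)//.
case: (leqP k.*2 m) => km; last first.
  rewrite /= !mulr0 subr0 ifF ?mulr0//; apply/negbTE; rewrite -ltnNge; lia.
have [r mE] : {r | m = (k.*2 + r)%N} by exists (m - k.*2)%N; rewrite subnKC.
have -> : (m.+2 - k.+1 = (k + r).+1)%N by lia.
have -> : (m.+1 - k.+1 = k + r)%N by lia.
have -> : (m - k = k + r)%N by lia.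
have -> : (m.+2 - k.*2.+2 = r)%N by lia.
have -> : (m.+1 - k.*2.+2 = r.-1)%N by lia.
have -> : (m - k.*2 = r)%N by lia.
rewrite risingS factS !natrM exprS.
have h1 : k`!%:R != 0 :> R by rewrite pnatr_eq0 -lt0n fact_gt0.
have h2 : k.+1%:R != 0 :> R by rewrite pnatr_eq0.
have mR : m%:R = k%:R *+ 2 + r%:R :> R by rewrite mE natrD -muln2 natrM mulr_natr.
case: r mE mR => [|r] mE mR.
  rewrite /= ifF; last by apply/negbTE; rewrite -ltnNge; lia.
  rewrite -(natr1 m.+1) -(natr1 m) mR -(natr1 k) fact0 in h2 *.
  rewrite natrD.
  move: (rising _ _ _) (k`!%:R) h1 k%:R h2 (_ ^+ k) => p f f0 a a0 b.
  by field; rewrite f0 a0.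
rewrite /= ifT; last by lia.
rewrite /= exprS factS natrM.
have h3 : r`!%:R != 0 :> R by rewrite pnatr_eq0 -lt0n fact_gt0.
have h4 : r.+1%:R != 0 :> R by rewrite pnatr_eq0.
rewrite -(natr1 m.+1) -(natr1 m) natrD mR -(natr1 k) -(natr1 r) in h2 h4 *.
move: (rising _ _ _) (k`!%:R) h1 (r`!%:R) h3 k%:R h2 r%:R h4 (_ ^+ k) (_ ^+ r)
  => p f f0 g g0 a a0 c c0 b e.
by field; rewrite f0 a0 g0 c0.
Qed.

(** The three-term recurrence holds summand by summand, the last one being
    shifted by one. *)
Lemma gegenbauer_rec l t m :
  m.+2%:R * gegenbauer l m.+2 t =
  2 * (m.+1%:R + l) * t * gegenbauer l m.+1 t - (m%:R + 2 * l) * gegenbauer l m t.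
Proof.
rewrite (gegenbauer_termE l t m.+2 m.+2); last lia.
rewrite (gegenbauer_termE l t m.+1 m.+2); last lia.
rewrite (gegenbauer_termE l t m m.+1); last lia.
have h0 := gegenbauer_term_rec0 l t m.
have hS k := gegenbauer_term_recS l t m k.
move: (2 * _ * t) h0 hS => c h0 hS.
rewrite !(big_ord_recl m.+1) !mulrDr h0 -addrA; congr (_ + _).
by rewrite !mulr_sumr -sumrB; apply: eq_bigr => k _; rewrite lift0 hS.
Qed.

Lemma gegenbauerN l m t : gegenbauer l m (- t) = (-1) ^+ m * gegenbauer l m t.
Proof.
rewrite /gegenbauer mulr_sumr; apply: eq_bigr => k _.
have -> : (2 * - t) ^+ (m - k.*2) = (-1) ^+ m * (2 * t) ^+ (m - k.*2).
  rewrite mulrN exprNn -signr_odd oddB; last by have := ltn_ord k; lia.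
  by rewrite odd_double addbF signr_odd.
by rewrite mulrCA.
Qed.

(** Up to the factor 2m + D + 1, the coefficient of the Gegenbauer polynomial of
    degree m and parameter (D+1)/2 in the expansion of ((1+t)/2)^n.  It vanishes
    for m > n because of the falling factorial. *)
Definition expansion_coef (D n m : nat) : R :=
  rising R (D.+2%:R / 2) n * (n ^_ m)%:R * D`!%:R / (n + m + D.+1)`!%:R.

Lemma ffactSR n m : (n ^_ m.+1)%:R = (n ^_ m)%:R * (n%:R - m%:R) :> R.
Proof.
rewrite ffactnSr natrM; have [nm|mn] := ltnP n m; last by rewrite natrB.
by rewrite ffact_small// !mul0r.
Qed.

Lemma expansion_coef_rec0 D n :
  D.+1%:R * expansion_coef D n 0 + D.+1%:R * expansion_coef D n 1 =
  2 * D.+1%:R * expansion_coef D n.+1 0.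
Proof.
rewrite /expansion_coef risingS !ffactn0 !addn0 ffactn1 addn1 addSn factS natrM.
have h1 : (n + D.+1)`!%:R != 0 :> R by rewrite pnatr_eq0 -lt0n fact_gt0.
have h2 : (n + D.+1).+1%:R != 0 :> R by rewrite pnatr_eq0.
have E : (n + D.+1).+1%:R = n%:R + D%:R + 2 :> R by rewrite -!natrD; congr _%:R; lia.
have E2 : D.+2%:R = D%:R + 2 :> R by rewrite -addn2 natrD.
rewrite E E2 in h2 *.
move: (rising _ _ _) (_`!%:R) (_`!%:R) h1 D.+1%:R => r g f f0 d.
by field; rewrite f0 h2.
Qed.

Lemma expansion_coef_recS D n m :
  (2 * m.+1 + D.+1)%:R * expansion_coef D n m.+1 +
    m.+1%:R * expansion_coef D n m + (m.+2 + D)%:R * expansion_coef D n m.+2 =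
  2 * (2 * m.+1 + D.+1)%:R * expansion_coef D n.+1 m.+1.
Proof.
rewrite /expansion_coef risingS ffactSS (ffactSR n m.+1) (ffactSR n m).
have -> : (n + m.+1 + D.+1 = (n + m + D.+1).+1)%N by lia.
have -> : (n + m.+2 + D.+1 = (n + m + D.+1).+2)%N by lia.
have -> : (n.+1 + m.+1 + D.+1 = (n + m + D.+1).+2)%N by lia.
have h1 : (n + m + D.+1)`!%:R != 0 :> R by rewrite pnatr_eq0 -lt0n fact_gt0.
have h2 : (n + m + D.+1).+1%:R != 0 :> R by rewrite pnatr_eq0.
have h3 : (n + m + D.+1).+2%:R != 0 :> R by rewrite pnatr_eq0.
have f1 : (n + m + D.+1).+1`!%:R = (n + m + D.+1).+1%:R * (n + m + D.+1)`!%:R :> R.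
  by rewrite factS natrM.
have f2 : (n + m + D.+1).+2`!%:R = (n + m + D.+1).+2%:R * (n + m + D.+1).+1`!%:R :> R.
  by rewrite factS natrM.
rewrite f2 f1 (natrM _ n.+1) {f1 f2}.
have E3 : (n + m + D.+1).+2%:R = n%:R + m%:R + D%:R + 3 :> R.
  by rewrite -!natrD; congr _%:R; lia.
have E4 : (n + m + D.+1).+1%:R = n%:R + m%:R + D%:R + 2 :> R.
  by rewrite -!natrD; congr _%:R; lia.
have E2 : D.+2%:R = D%:R + 2 :> R by rewrite -!natrD; congr _%:R; lia.
have E5 : (2 * m.+1 + D.+1)%:R = 2 * m%:R + D%:R + 3 :> R.
  by rewrite -natrM -!natrD; congr _%:R; lia.
have E6 : (m.+2 + D)%:R = m%:R + D%:R + 2 :> R by rewrite -!natrD; congr _%:R; lia.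
rewrite E3 E4 E2 E5 E6 -(natr1 n) -(natr1 m) in h2 h3 *.
move: (rising _ _ _) ((n ^_ m)%:R) (D`!%:R) (_`!%:R) h1 => r p g f f0.
move: (n%:R) (m%:R) (D%:R) h2 h3 => a b c h2 h3.
by field; rewrite f0 h2 h3.
Qed.

(** Induction on n: multiply by (1+t)/2, expand t C_m by the three-term
    recurrence, and compare coefficients by means of [expansion_coef_rec0] and
    [expansion_coef_recS]. *)
Lemma gegenbauer_expansion D n t :
  ((1 + t) / 2) ^+ n =
  \sum_(m < n.+1) (2 * m + D.+1)%:R * expansion_coef D n m *
     gegenbauer (D.+1%:R / 2) m t.
Proof.
set C := fun m => gegenbauer (D.+1%:R / 2) m t.
have C0 : C 0 = 1 by exact: gegenbauer0.
have C1 : D.+1%:R * t * C 0 = C 1.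
  by rewrite C0 /C gegenbauer1 mulr1; field.
have CS m : (2 * m.+1 + D.+1)%:R * t * C m.+1 = m.+2%:R * C m.+2 + (m + D.+1)%:R * C m.
  rewrite /C gegenbauer_rec (natrD _ m) (natrD _ (2 * m.+1)) natrM.
  by field.
have v0 k m : (k < m)%N -> expansion_coef D k m = 0.
  by move=> km; rewrite /expansion_coef ffact_small// mulr0 !mul0r.
pose S k := \sum_(m < k.+1) (2 * m + D.+1)%:R * expansion_coef D k m * C m.
rewrite -/(S n); elim: n => [|n IH].
  rewrite expr0 /S big_ord1 C0 /expansion_coef /rising big_ord0 ffactn0 muln0 !add0n factS natrM.
  have h : D`!%:R != 0 :> R by rewrite pnatr_eq0 -lt0n fact_gt0.
  have h' : D.+1%:R != 0 :> R by rewrite pnatr_eq0.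
  by move: (D.+1%:R) h' (D`!%:R) h => a a0 b b0; field; rewrite b0 a0.
rewrite exprSr IH.
pose v := expansion_coef D n.
have SE : S n = \sum_(m < n.+2) (2 * m + D.+1)%:R * v m * C m.
  by rewrite big_ord_recr/= /v v0// mulr0 mul0r addr0.
have tS : S n * t = \sum_(m < n.+1) v m * m.+1%:R * C m.+1
                    + \sum_(m < n.+2) v m.+1 * (m + D.+1)%:R * C m.
  rewrite [X in _ = _ + X]big_ord_recr/= /v v0// !mul0r addr0.
  rewrite [X in _ = _ + X]big_ord_recr/= v0// !mul0r addr0.
  rewrite /S !(big_ord_recl n) /= muln0 add0n mulrDl -addrA.
  congr (_ + _); first by rewrite -C1; ring.
  rewrite mulr_suml -big_split/=; apply: eq_bigr => m _; rewrite /bump/= add1n.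
  transitivity (expansion_coef D n m.+1 * ((2 * m.+1 + D.+1)%:R * t * C m.+1)).
    by ring.
  by rewrite CS; ring.
rewrite (_ : S n * _ = (S n + S n * t) / 2); last by ring.
rewrite tS SE; apply: (canLR (mulfK _)); first by rewrite pnatr_eq0.
rewrite /S !(big_ord_recl n.+1) mulrDl mulr_suml.
have -> : forall x y z w u : R, x + y + (z + (w + u)) = (x + w) + (y + z + u).
  by move=> *; ring.
congr (_ + _).
  transitivity ((2 * D.+1%:R * expansion_coef D n.+1 0) * C 0); last first.
    by rewrite muln0 add0n; ring.
  by rewrite -expansion_coef_rec0 muln0 !add0n -/(v 0) -/(v 1); ring.
rewrite -!big_split/=; apply: eq_bigr => m _; rewrite !/bump/= !add1n.
transitivity ((2 * (2 * m.+1 + D.+1)%:R * expansion_coef D n.+1 m.+1) * C m.+1); last first.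
  by ring.
rewrite -expansion_coef_recS -/(v _) -/(v _) -/(v _).
rewrite (_ : (m.+2 + D = m.+1 + D.+1)%N); last by lia.
by ring.
Qed.

(** C_m has the parity of m, so adding the value at -t doubles the even terms and
    cancels the odd ones. *)
Lemma gegenbauer_even_expansion D n t :
  ((1 + t) / 2) ^+ n + ((1 - t) / 2) ^+ n =
  2 * \sum_(0 <= m < n.+1 | ~~ odd m) (2 * m + D.+1)%:R * expansion_coef D n m *
     gegenbauer (D.+1%:R / 2) m t.
Proof.
rewrite !(gegenbauer_expansion D) -big_split/= -(big_mkord xpredT (fun m =>
  (2 * m + D.+1)%:R * expansion_coef D n m * gegenbauer (D.+1%:R / 2) m t +
  (2 * m + D.+1)%:R * expansion_coef D n m * gegenbauer (D.+1%:R / 2) m (- t))).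
rewrite mulr_sumr [RHS]big_mkcond/=; apply: eq_bigr => m _.
rewrite gegenbauerN -signr_odd; case: (odd m) => /=; ring.
Qed.

End Gegenbauer.

(** * Normalisation constants *)

(** Locked, because the unifier would otherwise unfold Euler's integral. *)
HB.lock Definition half_gamma (R : realType) (p : nat) : R := Gamma (p%:R / 2).

Section HalfIntegers.
Variable R : realType.
Notation H := (@half_gamma R).

Lemma half_gammaE p : Gamma (p%:R / 2 : R) = H p.
Proof. by rewrite half_gamma.unlock. Qed.

Lemma Gamma_nat n : Gamma (n.+1%:R : R) = n`!%:R.
Proof.
elim: n => [|n IH]; first by rewrite Gamma1 fact0.
by rewrite -(natr1 n.+1) GammaS ?ltr0n// IH factS natrM.
Qed.

Lemma half_gammaD p m : Gamma (p%:R / 2 + m%:R : R) = H (p + m.*2).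
Proof. by rewrite -half_gammaE natrD mulrDl -muln2 natrM mulfK. Qed.

Lemma half_gammaSS p : (0 < p)%N -> H p.+2 = p%:R / 2 * H p.
Proof.
move=> p0; rewrite -!half_gammaE.
have p20 : 0 < p%:R / 2 :> R by rewrite divr_gt0 ?ltr0n.
have -> : p.+2%:R / 2 = p%:R / 2 + 1 :> R by rewrite -addn2 natrD mulrDl divff.
exact: GammaS.
Qed.

Lemma half_gamma1 : H 1 = Num.sqrt pi.
Proof. by rewrite -half_gammaE mul1r Gamma_half. Qed.

Lemma half_gamma2 : H 2 = 1.
Proof. by rewrite -half_gammaE divff// Gamma1. Qed.

Lemma half_gamma_gt0 p : (0 < p)%N -> 0 < H p.
Proof.
have [n] := ubnP p; elim: n p => // n IH [|[|[|p]]]//.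
- by rewrite half_gamma1 sqrtr_gt0 pi_gt0.
- by rewrite half_gamma2.
- move=> pn _; rewrite half_gammaSS// mulr_gt0// ?divr_gt0//.
  by apply: IH => //; lia.
Qed.

(** Legendre's duplication formula at half-integers, by induction from the
    values at 1/2 and 1. *)
Lemma half_gamma_double p : Num.sqrt pi * p`!%:R = 2 ^+ p * H p.+1 * H p.+2.
Proof.
elim: p => [|p IH].
  by rewrite half_gamma1 half_gamma2 expr0 fact0; ring.
rewrite (half_gammaSS p.+1)// factS natrM mulrCA IH exprS.
by field.
Qed.

Lemma half_gamma_rising p n : (0 < p)%N ->
  H (p + n.*2) = rising R (p%:R / 2) n * H p.
Proof.
move=> p0; elim: n => [|n IH]; first by rewrite addn0 /rising big_ord0 mul1r.
rewrite doubleS !addnS half_gammaSS ?addn_gt0 ?p0// IH /rising big_ord_recr/=.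
by rewrite mulrA; congr (_ * _); rewrite mulrC natrD -muln2 natrM; field.
Qed.

(** When two consecutive indices agree, duplication collapses the corresponding
    factor of the squared normalisation constant to a power of 2 (the same for
    all factors) times a quotient of two consecutive half-integer values, so that
    a product of such factors telescopes. *)
Lemma Acoef_factor d i k : (i.+2 < d)%N ->
  2 ^ (2 * k%:Z - i%:Z) * (k - k)`!%:R * (2 * k + d - i - 2)%:R *
    Gamma ((d - i - 2)%:R / 2 + k%:R : R) ^+ 2 /
    (Num.sqrt pi * Gamma (k + k + d - i - 2)%:R)
  = 2 ^ (4 - d%:Z) * (H (2 * k + d - i) / H (2 * k + d - i.+1)).
Proof.
move=> id.
have [q qE q0] : {q | (2 * k + d - i - 2 = q)%N & (0 < q)%N}.
  by exists (2 * k + d - i - 2)%N => //; lia.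
have -> : (k + k + d - i - 2 = q)%N by lia.
rewrite qE.
have -> : (2 * k + d - i = q.+2)%N by lia.
have -> : (2 * k + d - i.+1 = q.+1)%N by lia.
have -> : ((d - i - 2)%:R / 2 + k%:R : R) = q%:R / 2.
  rewrite -qE -[X in _ + X](mulfK (_ : 2 != 0))// -mulrDl; congr (_ / _).
  by rewrite -natrM -natrD; congr _%:R; lia.
rewrite subnn fact0 mulr1 half_gammaSS//.
case: q q0 qE => // q _ qE.
have h0 := lt0r_neq0 (half_gamma_gt0 q.+1 isT).
have h1 := lt0r_neq0 (half_gamma_gt0 q.+2 isT).
rewrite Gamma_nat half_gamma_double half_gammaE.
have -> : 2 ^ (2 * k%:Z - i%:Z) = 2 ^ (4 - d%:Z) * 2 ^+ q / 2 :> R.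
  rewrite exprnP -[_ / 2]/(_ * (2 ^ (1%:Z))^-1) invr_expz -!expfzDr//.
  by congr exprz; lia.
by field; rewrite h0 h1 expf_neq0.
Qed.

Lemma prod_Acoef_factor (d k j0 l : nat) : (j0 + l + 2 <= d)%N ->
  \prod_(i < l) (2 ^ (4 - d%:Z) *
     (H (2 * k + d - (j0 + i)) / H (2 * k + d - (j0 + i).+1)))
  = (2 ^ (4 - d%:Z)) ^+ l * (H (2 * k + d - j0) / H (2 * k + d - (j0 + l))).
Proof.
elim: l => [|l IH] hd.
  rewrite big_ord0 expr0 mul1r addn0 divff// lt0r_neq0// half_gamma_gt0//; lia.
rewrite big_ord_recr/= IH; last lia.
have h0 : H (2 * k + d - (j0 + l)) != 0 by rewrite lt0r_neq0// half_gamma_gt0//; lia.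
have h1 : H (2 * k + d - (j0 + l).+1) != 0 by rewrite lt0r_neq0// half_gamma_gt0//; lia.
by rewrite exprS addnS; field; apply/andP.
Qed.

Lemma Gamma_ge0 (x : R) : 0 <= Gamma x.
Proof.
apply: Rintegral_ge0 => t _; exact: gamma_integrand_ge0.
Qed.

Lemma Acoef_sqr d n (k : seq int) (K := fun i => absz (nth 0 (n%:Z :: k) i)) :
  Acoef R d n k ^+ 2 =
  2 ^ ((d%:Z - 4) * (d%:Z - 2)) / Gamma (d%:R / 2) *
     \prod_(i < d - 2)
       (2 ^ (2 * (K i.+1)%:Z - i%:Z) * (K i - K i.+1)`!%:R *
        (2 * K i + d - i - 2)%:R *
        Gamma ((d - i - 2)%:R / 2 + (K i.+1)%:R) ^+ 2 /
        (Num.sqrt pi * Gamma (K i + K i.+1 + d - i - 2)%:R)).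
Proof.
rewrite sqr_sqrtr//; apply: mulr_ge0.
  by apply: divr_ge0; [exact: exprz_ge0|exact: Gamma_ge0].
apply: prodr_ge0 => i _; apply: divr_ge0; last first.
  by apply: mulr_ge0; [exact: sqrtr_ge0|exact: Gamma_ge0].
apply: mulr_ge0; last exact: sqr_ge0.
by apply: mulr_ge0; [apply: mulr_ge0; [exact: exprz_ge0|]|]; exact: ler0n.
Qed.

(** All indices agree: the whole product telescopes, and the prefactor removes
    the powers of 2. *)
Lemma Acoef_nseq_sqr d n : (3 <= d)%N ->
  Acoef R d n (nseq (d - 2) n%:Z) ^+ 2 = H (d + n.*2) / (n`!%:R * H d).
Proof.
move=> d3; rewrite Acoef_sqr.
rewrite half_gammaE.
rewrite (eq_bigr (fun i : 'I_(d - 2) => 2 ^ (4 - d%:Z) *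
     (H (2 * n + d - (0 + i)) / H (2 * n + d - (0 + i).+1)))); last first.
  move=> i _; have id : (i.+2 < d)%N by have := ltn_ord i; lia.
  rewrite add0n -(Acoef_factor d i n id).
  have -> : absz (nth 0 (n%:Z :: nseq (d - 2) n%:Z) i) = n.
    by case: i {id} => -[|i] //= hi; rewrite nth_nseq ifT//; lia.
  by have -> : absz (nth 0 (n%:Z :: nseq (d - 2) n%:Z) i.+1) = n
    by rewrite /= nth_nseq ltn_ord.
rewrite prod_Acoef_factor ?subn0; last lia.
have -> : (2 * n + d - (0 + (d - 2)) = n.*2.+2)%N by lia.
have -> : (2 * n + d = d + n.*2)%N by lia.
have -> : H n.*2.+2 = n`!%:R.
  by rewrite -half_gammaE -muln2 -addn2 natrD natrM mulrDl mulfK// divff// natr1 Gamma_nat.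
have hd := lt0r_neq0 (half_gamma_gt0 d (ltnW (ltnW d3))).
have -> : (2 ^ (4 - d%:Z)) ^+ (d - 2) = (2 ^ ((d%:Z - 4) * (d%:Z - 2)))^-1 :> R.
  rewrite exprnP exprz_exp invr_expz; congr exprz.
  by rewrite (_ : Posz (d - 2) = d%:Z - 2); [ring|lia].
have p0 : 2 ^ ((d%:Z - 4) * (d%:Z - 2)) != 0 :> R by rewrite expfz_neq0.
have n0 : n`!%:R != 0 :> R by rewrite pnatr_eq0 -lt0n fact_gt0.
by field; rewrite hd p0 n0.
Qed.

(** From the second index on all indices vanish, so all factors but the first two
    telescope. *)
Lemma Acoef_zonal_sqr d n m : (4 <= d)%N ->
  Acoef R d n (m%:Z :: nseq (d - 3) 0) ^+ 2 =
    4 ^+ (d - 4) * H (d - 2) / H d *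
    (4 ^+ m * (n - m)`!%:R * (2 * n + d - 2)%:R * H (d - 2 + m.*2) ^+ 2 /
      (Num.sqrt pi * (n + m + d - 3)`!%:R)) *
    (m`!%:R * (2 * m + d - 3)%:R * H (d - 3) ^+ 2 /
      (2 * Num.sqrt pi * (m + d - 4)`!%:R)).
Proof.
move=> d4; rewrite Acoef_sqr.
have nth0s i : nth 0 (nseq (d - 3) 0) i = 0 :> int by rewrite nth_nseq if_same.
have [D dD] : {D | d = D.+4} by exists (d - 4)%N; lia.
have -> : (d - 2 = D.+2)%N by lia.
rewrite half_gammaE !big_ord_recl.
rewrite (eq_bigr (fun i : 'I_D => 2 ^ (4 - d%:Z) *
     (H (2 * 0 + d - (2 + i)) / H (2 * 0 + d - (2 + i).+1)))); last first.
  move=> i _; rewrite -(Acoef_factor d (2 + i) 0); last by have := ltn_ord i; lia.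
  by rewrite !lift0 /= !nth0s !absz0.
rewrite prod_Acoef_factor; last by lia.
rewrite lift0 /= nth0s absz0 add0n.
have -> : (d - (2 + D) = 2)%N by lia.
have -> : (d - 3 = D.+1)%N by lia.
have -> : (d - 4 = D)%N by lia.
have -> : (n + m + d - 0 - 2 = (n + m + d - 3).+1)%N by lia.
have -> : (m + 0 + d - 1 - 2 = (m + d - 4).+1)%N by lia.
have -> : (2 * n + d - 0 - 2 = 2 * n + d - 2)%N by lia.
have -> : (2 * m + d - 1 - 2 = 2 * m + d - 3)%N by lia.
have -> : (d - 0 - 2 = D.+2)%N by lia.
have -> : (d - 1 - 2 = D.+1)%N by lia.
have -> : (d - 2 = D.+2)%N by lia.
rewrite !Gamma_nat (addr0 (D.+1%:R / 2)) half_gammaE half_gamma2 subn0.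
have -> : Gamma (D.+2%:R / 2 + m%:R : R) = H (D.+2 + m.*2).
  exact: half_gammaD.
have -> : 2 ^ (2 * 0%Z - 1%Z) = 2^-1 :> R by [].
have -> : 2 ^ (2 * m%:Z - 0%Z) = 4 ^+ m :> R.
  by rewrite subr0 -exprz_exp -[LHS]exprnP -exprnP; congr (_ ^+ _); ring.
have p0 : (2 ^ (4 - d%:Z)) ^+ D != 0 :> R by rewrite expf_neq0// expfz_neq0.
have -> : 2 ^ ((d%:Z - 4) * (d%:Z - 2)) = 4 ^+ D / ((2 ^ (4 - d%:Z)) ^+ D) :> R.
  rewrite (_ : 4 = 2 ^ 2%:Z :> R); last by rewrite -exprnP; ring.
  rewrite !exprnP !exprz_exp invr_expz -expfzDr//; congr exprz.
  rewrite dD (_ : Posz D.+4 = D%:Z + 4); last by lia.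
  by ring.
have hd := lt0r_neq0 (half_gamma_gt0 d (ltnW (ltnW (ltnW d4)))).
have spi : Num.sqrt pi != 0 :> R by rewrite lt0r_neq0// sqrtr_gt0 pi_gt0.
have f1 : (n + m + d - 3)`!%:R != 0 :> R by rewrite pnatr_eq0 -lt0n fact_gt0.
have f2 : (m + d - 4)`!%:R != 0 :> R by rewrite pnatr_eq0 -lt0n fact_gt0.
move: (_ ^+ D) p0 (_ ^+ D) (_ ^+ m) => p p0 q r.
move: (Num.sqrt pi) spi (_`!%:R) f1 (_`!%:R) f2 (H d) hd => s spi F1 f1 F2 f2 hD hd.
move: (n - m)`!%:R m`!%:R (2 * n + d - 2)%:R (2 * m + d - 3)%:R => F3 F4 a b.
move: (H _) (H _) (H _) => h1 h2 h3.
by field; rewrite f2 spi f1 hd p0.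
Qed.

Lemma normc_real (a : R) : Normc.normc a%:C ^+ 2 = a ^+ 2.
Proof. by rewrite /= expr0n addr0 sqr_sqrtr ?sqr_ge0. Qed.

Lemma normc_expNi m : Normc.normc ((- 'i : R[i]) ^+ m) = 1.
Proof.
elim: m => [|m IH]; first by rewrite expr0 Normc.normc1.
rewrite exprS Normc.normcM IH mulr1 /=.
by rewrite oppr0 expr0n/= add0r sqrrN expr1n sqrtr1.
Qed.

Lemma normc_monomial_sqr (a b c : R) m :
  Normc.normc (a%:C * (b%:C * (- 'i) ^+ m / c%:C)) ^+ 2 = a ^+ 2 * (b / c) ^+ 2.
Proof.
rewrite !Normc.normcM Normc.normcV normc_expNi mulr1 !exprMn exprVn.
by rewrite !normc_real -exprVn -exprMn.
Qed.

Lemma normc_ccoef_sqr d n m (a b : R) :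
  Acoef R d n (m%:Z :: nseq (d - 3) 0) ^+ 2 = a ->
  Acoef R d n (nseq (d - 2) n%:Z) ^+ 2 = b ->
  Normc.normc (ccoef R d n m) ^+ 2 = a * b *
  ((Num.sqrt pi * Gamma (d%:R / 2) * 'C(n, m)%:R * Gamma (m + d - 3)%:R) /
   (2 ^+ (m + d - 4) * (n%:R + (d - 2)%:R / 2) * Gamma ((d - 2)%:R / 2) *
    Gamma ((d - 3)%:R / 2) * Gamma (m%:R + (d - 2)%:R / 2))) ^+ 2.
Proof.
move=> <- <-; rewrite -exprMn /ccoef normc_monomial_sqr; reflexivity.
Qed.

(** The factors (-i)^m have modulus 1 and all half-integer Gamma values cancel,
    which leaves the coefficient of the Gegenbauer expansion of ((1+t)/2)^n. *)
Lemma weight_ccoef d n m : (4 <= d)%N -> (m <= n)%N ->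
  Normc.normc (ccoef R d n m) ^+ 2 *
    (Gamma ((d - 3)%:R : R) * m`!%:R / Gamma (m + d - 3)%:R) =
  (2 * m + (d - 4).+1)%:R * expansion_coef R (d - 4) n m.
Proof.
move=> d4 mn.
rewrite (normc_ccoef_sqr d n m _ _ (Acoef_zonal_sqr d n m d4)
  (Acoef_nseq_sqr d n (ltnW d4))).
rewrite /expansion_coef.
have -> : ((d - 4).+2 = d - 2)%N by lia.
have -> : (2 * m + (d - 4).+1 = 2 * m + d - 3)%N by lia.
have -> : (n + m + (d - 4).+1 = n + m + d - 3)%N by lia.
have [D dD] : {D | d = D.+4} by exists (d - 4)%N; lia.
have -> : Gamma (m%:R + (d - 2)%:R / 2 : R) = H (d - 2 + m.*2).
  by rewrite addrC half_gammaD.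
rewrite !half_gammaE.
have -> : H (d + n.*2) = rising R ((d - 2)%:R / 2) n * H (d - 2) * (n%:R + (d - 2)%:R / 2).
  rewrite -half_gamma_rising; last by lia.
  rewrite (_ : (d + n.*2 = (d - 2 + n.*2).+2)%N); last by lia.
  rewrite half_gammaSS; last by lia.
  by rewrite natrD -muln2 natrM; field.
have -> : H d = (d - 2)%:R / 2 * H (d - 2).
  by rewrite -half_gammaSS; [congr H; lia | lia].
have -> : (m + d - 3 = (m + d - 4).+1)%N by lia.
have -> : (d - 3 = (d - 4).+1)%N by lia.
rewrite !Gamma_nat.
have nE : (2 * n + d - 2)%:R = 2 * (n%:R + (d - 2)%:R / 2) :> R.
  by rewrite (_ : (2 * n + d - 2 = n * 2 + (d - 2))%N) ?natrD ?natrM; [field | lia].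
have twoE : (2 ^+ (m + d - 4)) ^+ 2 = 4 ^+ (d - 4) * 4 ^+ m :> R.
  rewrite -exprM -exprD mulnC exprM; congr (_ ^+ _); first by ring.
  by lia.
have ffE : (n ^_ m)%:R = 'C(n, m)%:R * m`!%:R :> R by rewrite -bin_ffact natrM.
have nf : n`!%:R = 'C(n, m)%:R * (m`!%:R * (n - m)`!%:R) :> R.
  by rewrite -!natrM bin_fact.
have mu0 : 0 < (d - 2)%:R :> R by rewrite ltr0n; lia.
have X0 : n%:R + (d - 2)%:R / 2 != 0 :> R.
  by rewrite lt0r_neq0// ltr_wpDl ?divr_gt0.
have h20 : H (d - 2) != 0 by rewrite lt0r_neq0// half_gamma_gt0; lia.
have h10 : H (d - 4).+1 != 0 by rewrite lt0r_neq0// half_gamma_gt0.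
have hm0 : H (d - 2 + m.*2) != 0 by rewrite lt0r_neq0// half_gamma_gt0; lia.
have spi : Num.sqrt pi != 0 :> R by rewrite lt0r_neq0// sqrtr_gt0 pi_gt0.
have fact0 k : k`!%:R != 0 :> R by rewrite pnatr_eq0 -lt0n fact_gt0.
have f1 := fact0 (n + m + d - 3)%N; have f2 := fact0 (m + d - 4)%N.
have f3 := fact0 (n - m)%N; have f4 := fact0 m.
have C0 : 'C(n, m)%:R != 0 :> R by rewrite pnatr_eq0 -lt0n bin_gt0.
have q0 k : 4 ^+ k != 0 :> R by rewrite expf_neq0.
have q1 := q0 (d - 4)%N; have q2 := q0 m.
rewrite expr_div_n !exprMn twoE nE ffE nf {nE twoE ffE nf}.
move: (4 ^+ (d - 4)) q1 (4 ^+ m) q2 => q1 q10 q2 q20.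
move: ('C(n, m)%:R) C0 => C C0.
move: ((n - m)`!%:R) f3 (m`!%:R) f4 ((n + m + d - 3)`!%:R) f1 ((m + d - 4)`!%:R) f2
  => f3 f30 f4 f40 f1 f10 f2 f20.
move: (n%:R + _) X0 => X X0.
move: (Num.sqrt pi : R) spi (H (d - 2)) h20 (H _) h10 (H _) hm0 (rising _ _ _)
  => s s0 h2 h20 h1 h10 hm hm0 r.
move: ((d - 2)%:R) mu0 => mu /lt0r_neq0 mu0.
by field; rewrite f10 f20 hm0 h10 h20 X0 q20 q10 mu0 f30 f40 C0 s0.
Qed.

End HalfIntegers.

(** * Rotation-invariant means on the sphere *)

Section SphereMean.
Variables (R : realType) (d : nat) (omega : probability (borel_space R d) R).
Hypothesis omega_inv : rotation_invariant omega.
Notation vec := 'cV[R]_d.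
Notation S := (@unit_sphere R d).
Implicit Types (f g : vec -> R) (F G : vec -> R[i]) (c : R[i]).

Lemma open_continuous_borel f : continuous f ->
  measurable_fun [set: borel_space R d] (f : borel_space R d -> R).
Proof.
move=> cf; apply: (measurability _ (RGenOpens.measurableE R)).
move=> _ [_ [a [b ->] <-]]; rewrite setTI; apply: sub_sigma_algebra.
by apply: open_comp; [move=> x _; exact: cf|exact: interval_open].
Qed.

Lemma mulmx_continuous (h : 'M[R]_d) : continuous (fun x : vec => h *m x).
Proof.
move=> x A [P Px PA].
have Pi (i : 'I_d) (j : 'I_1) : nbhs x [set y : vec | P i j ((h *m y) i j)].
  have : {for x, continuous (fun y : vec => (h *m y) i j)}.
    rewrite (_ : (fun _ => _) = fun y : vec => \sum_k h i k * y k j); last first.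
      by apply/funext => y; rewrite mxE.
    move: x {Px}; apply: continuous_big => [|k _ y]; first exact: add_continuous.
    by apply: continuousM; [exact: cst_continuous|exact: coord_continuous].
  by move=> c; exact: (c _ (Px i j)).
have {}Pi i := @filter_forall _ _ _ _ (nbhs_filter x) (Pi i).
have {}Pi := @filter_forall _ _ _ _ (nbhs_filter x) Pi.
by apply: filterS Pi => y; exact: PA.
Qed.

Lemma measurable_mulmx (h : 'M[R]_d) :
  measurable_fun [set: borel_space R d]
    ((fun x : vec => h *m x) : borel_space R d -> borel_space R d).
Proof.
apply: (@measurability _ _ (borel_space R d) (borel_space R d) setT _ (@open vec)) => //.
move=> _ [A oA <-]; rewrite setTI; apply: sub_sigma_algebra.
by apply: open_comp => // x _; exact: mulmx_continuous.
Qed.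

(** A class of integrable functions that is closed under products, as square
    integrability would not be, and under rotations. *)
Definition tame f :=
  measurable_fun [set: borel_space R d] (f : borel_space R d -> R) /\
  exists M, forall x, S x -> `|f x| <= M.

Lemma tame_cst (a : R) : tame (fun=> a).
Proof. by split; [exact: measurable_cst|exists `|a|]. Qed.

Lemma tameD f g : tame f -> tame g -> tame (fun x => f x + g x).
Proof.
move=> [mf [M fM]] [mg [N gN]]; split; first exact: measurable_funD.
by exists (M + N) => x Sx; rewrite (le_trans (ler_normD _ _))// lerD ?fM ?gN.
Qed.

Lemma tameM f g : tame f -> tame g -> tame (fun x => f x * g x).
Proof.
move=> [mf [M fM]] [mg [N gN]]; split; first exact: measurable_funM.
by exists (M * N) => x Sx; rewrite normrM ler_pM ?fM ?gN.
Qed.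

Lemma tameN f : tame f -> tame (fun x => - f x).
Proof.
move=> tf; have := tameM _ _ (tame_cst (-1)) tf.
by congr tame; apply/funext => x; rewrite mulN1r.
Qed.

Lemma norm_coord_le1 (x : vec) i : S x -> `|x i 0| <= 1.
Proof.
move=> Sx; rewrite -(@ler_pXn2r _ 2) ?nnegrE// expr1n -[leRHS]Sx real_normK ?num_real//.
rewrite /dot (bigD1 i)//= expr2 lerDl; apply: sumr_ge0 => k _.
by rewrite -expr2 sqr_ge0.
Qed.

Lemma tame_coord i : tame (fun x => x i 0).
Proof.
split; first by apply: open_continuous_borel; exact: coord_continuous.
by exists 1 => x; exact: norm_coord_le1.
Qed.

Lemma tame_sum (I : Type) (r : seq I) (f : I -> vec -> R) :
  (forall i, tame (f i)) -> tame (fun x => \sum_(i <- r) f i x).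
Proof.
move=> tf; elim: r => [|i r IH].
  by under eq_fun do rewrite big_nil; exact: tame_cst.
by under eq_fun do rewrite big_cons; exact: tameD.
Qed.

Lemma tame_dot (u : vec) : tame (fun x => dot x u).
Proof.
by apply: tame_sum => i; apply: tameM; [exact: tame_coord|exact: tame_cst].
Qed.

Lemma measurable_sphere : measurable (S : set (borel_space R d)).
Proof.
have m : measurable_fun [set: borel_space R d]
    ((fun x : vec => dot x x) : borel_space R d -> R).
  apply: open_continuous_borel; apply: continuous_big => [|i _ x].
    exact: add_continuous.
  by apply: continuousM; exact: coord_continuous.
have := m measurableT [set 1] (measurable_set1 1).
by rewrite setTI.
Qed.

Lemma tame_integrable f : tame f ->
  omega.-integrable (S : set (borel_space R d)) (EFin \o f).
Proof.
move=> [mf [M fM]].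
apply: measurable_bounded_integrable; first exact: measurable_sphere.
- by rewrite (le_lt_trans (probability_le1 _ _)) ?ltry//; exact: measurable_sphere.
- exact: measurable_funTS.
- exists M; split; first exact: num_real.
  by move=> N MN x Sx; apply: le_trans (fM x Sx) (ltW MN).
Qed.

Lemma SO_invmx (h : 'M[R]_d) : SO h -> [/\ h \in unitmx, invmx h = h^T & SO (invmx h)].
Proof.
move=> [hhT hdet].
have hu : h \in unitmx by rewrite unitmxE hdet unitr1.
have hT : invmx h = h^T by rewrite -[LHS]mulmx1 -hhT mulKmx.
split=> //; split; last by rewrite hT det_tr.
by rewrite hT trmxK -hT mulVmx.
Qed.

Lemma dotE (x y : vec) : (dot x y)%:M = x^T *m y.
Proof.
by apply/matrixP => i j; rewrite !ord1 !mxE; apply: eq_bigr => k _; rewrite mxE.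
Qed.

Lemma dot_mulmx (h : 'M[R]_d) (x y : vec) : dot (h *m x) y = dot x (h^T *m y).
Proof.
have : (dot (h *m x) y)%:M = (dot x (h^T *m y))%:M :> 'M[R]_1.
  by rewrite !dotE trmx_mul mulmxA.
by move/matrixP/(_ 0 0); rewrite !mxE.
Qed.

Lemma sphere_mulmx (h : 'M[R]_d) x : SO h -> S (h *m x) = S x.
Proof.
move=> hSO; have [hu hT _] := SO_invmx _ hSO.
by rewrite /unit_sphere/= dot_mulmx -hT mulKmx.
Qed.

Lemma tame_mulmx (h : 'M[R]_d) f : SO h -> tame f -> tame (fun x => f (h *m x)).
Proof.
move=> hSO [mf [M fM]]; split.
  by apply: measurableT_comp mf _; exact: measurable_mulmx.
by exists M => x Sx; apply: fM; rewrite sphere_mulmx.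
Qed.

(** Invariance of the measure says that it equals its image under h. *)
Lemma Rintegral_mulmx (h : 'M[R]_d) f : SO h -> tame f ->
  (\int[omega]_(x in (S : set (borel_space R d))) f (h *m x) =
   \int[omega]_(x in (S : set (borel_space R d))) f x)%R.
Proof.
move=> hSO tf; rewrite /Rintegral; congr fine.
have mh := measurable_mulmx h.
have Sh : (fun x : borel_space R d => (h *m x : vec)) @^-1` S = S.
  by apply/seteqP; split=> x /=; rewrite -[_ (h *m x)]/(S (h *m x)) sphere_mulmx.
have tfh := tame_mulmx h f hSO tf.
transitivity (\int[pushforward omega
  (fun x : borel_space R d => (h *m x : borel_space R d))]_(x in
    (S : set (borel_space R d))) (f x)%:E)%E.
  rewrite (integral_pushforward mh (f := EFin \o f)) ?Sh//.
  - by apply/measurable_EFinP; exact: tf.1.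
  - exact: tame_integrable tfh.
  - exact: measurable_sphere.
apply: eq_measure_integral => A mA _.
exact: omega_inv.2.
Qed.

Definition sphere_mean F : R[i] :=
  (\int[omega]_(x in (S : set (borel_space R d))) complex.Re (F x))%R +i*
  (\int[omega]_(x in (S : set (borel_space R d))) complex.Im (F x))%R.

Lemma innerE F G : inner omega F G = sphere_mean (fun x => F x * ((G x)^*)%C).
Proof. by []. Qed.

Definition tameC F := tame (fun x => complex.Re (F x)) /\ tame (fun x => complex.Im (F x)).

Lemma tameC_cst c : tameC (fun=> c).
Proof. by split; exact: tame_cst. Qed.

Lemma tameCD F G : tameC F -> tameC G -> tameC (fun x => F x + G x).
Proof.
move=> [F1 F2] [G1 G2]; split.
  by under eq_fun do rewrite raddfD; exact: tameD.
by under eq_fun do rewrite raddfD; exact: tameD.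
Qed.

Lemma ReM (a b : R[i]) :
  complex.Re (a * b) = complex.Re a * complex.Re b - complex.Im a * complex.Im b.
Proof. by case: a b => [? ?] [? ?]. Qed.

Lemma ImM (a b : R[i]) :
  complex.Im (a * b) = complex.Re a * complex.Im b + complex.Im a * complex.Re b.
Proof. by case: a b => [? ?] [? ?]. Qed.

Lemma tameCM F G : tameC F -> tameC G -> tameC (fun x => F x * G x).
Proof.
move=> [F1 F2] [G1 G2]; split.
  under eq_fun do rewrite ReM; apply: tameD; first exact: tameM.
  by apply: tameN; exact: tameM.
by under eq_fun do rewrite ImM; apply: tameD; exact: tameM.
Qed.

Lemma tameCZ c F : tameC F -> tameC (fun x => c * F x).
Proof. by apply: tameCM; exact: tameC_cst. Qed.

Lemma tameC_conj F : tameC F -> tameC (fun x => ((F x)^*)%C).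
Proof.
move=> [F1 F2]; split.
  by move: F1; congr tame; apply/funext => x; case: (F x).
by move: (tameN _ F2); congr tame; apply/funext => x; case: (F x).
Qed.

Lemma tameCX F n : tameC F -> tameC (fun x => F x ^+ n).
Proof.
move=> tF; elim: n => [|n IH]; first by under eq_fun do rewrite expr0; exact: tameC_cst.
by under eq_fun do rewrite exprS; exact: tameCM.
Qed.

Lemma tameC_real f : tame f -> tameC (fun x => (f x)%:C).
Proof. by move=> tf; split=> //; exact: tame_cst. Qed.

Lemma tameC_sum (I : Type) (r : seq I) (P : pred I) (G : I -> vec -> R[i]) :
  (forall i, tameC (G i)) -> tameC (fun x => \sum_(i <- r | P i) G i x).
Proof.
move=> tF; elim: r => [|i r IH].
  by under eq_fun do rewrite big_nil; exact: tameC_cst.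
under eq_fun do rewrite big_cons; case: (P i) => //.
exact: tameCD.
Qed.

Lemma tameC_mulmx (h : 'M[R]_d) F : SO h -> tameC F -> tameC (fun x => F (h *m x)).
Proof.
move=> hSO [F1 F2]; split; first exact: (tame_mulmx h _ hSO F1).
exact: (tame_mulmx h _ hSO F2).
Qed.

Lemma eq_sphere_mean F G : (forall x, S x -> F x = G x) -> sphere_mean F = sphere_mean G.
Proof.
move=> FG; rewrite /sphere_mean; congr (_ +i* _).
  by apply: eq_Rintegral => x /set_mem Sx; rewrite FG.
by apply: eq_Rintegral => x /set_mem Sx; rewrite FG.
Qed.

Lemma sphere_meanD F G : tameC F -> tameC G ->
  sphere_mean (fun x => F x + G x) = sphere_mean F + sphere_mean G.
Proof.
move=> [F1 F2] [G1 G2]; rewrite /sphere_mean.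
have mS := measurable_sphere.
rewrite -[RHS]/(_ +i* _) /=; congr (_ +i* _).
  under eq_Rintegral do rewrite raddfD.
  by rewrite RintegralD//; exact: tame_integrable.
under eq_Rintegral do rewrite raddfD.
by rewrite RintegralD//; exact: tame_integrable.
Qed.

Lemma sphere_meanZ c F : tameC F ->
  sphere_mean (fun x => c * F x) = c * sphere_mean F.
Proof.
move=> [F1 F2]; rewrite /sphere_mean.
have mS := measurable_sphere.
have iZ (a : R) f : tame f ->
    omega.-integrable (S : set (borel_space R d)) (EFin \o (fun x => a * f x)).
  by move=> tf; apply: tame_integrable; apply: tameM => //; exact: tame_cst.
case: c => a b; rewrite -[RHS]/(_ +i* _) /=; congr (_ +i* _).
  under eq_Rintegral do rewrite ReM /=.
  by rewrite RintegralB ?RintegralZl//; first [exact: tame_integrable | exact: iZ].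
under eq_Rintegral do rewrite ImM /=.
by rewrite RintegralD ?RintegralZl//; first [exact: tame_integrable | exact: iZ].
Qed.

Lemma sphere_mean_conj F : tameC F ->
  sphere_mean (fun x => ((F x)^*)%C) = ((sphere_mean F)^*)%C.
Proof.
move=> [F1 F2]; rewrite /sphere_mean /=; congr (_ +i* _).
  by apply: eq_Rintegral => x _; case: (F x).
rewrite -mulN1r -RintegralZl//; last 2 first.
- exact: measurable_sphere.
- exact: tame_integrable.
by apply: eq_Rintegral => x _; case: (F x) => a b /=; rewrite mulN1r.
Qed.

Lemma sphere_mean_sum (I : Type) (r : seq I) (P : pred I) (G : I -> vec -> R[i]) :
  (forall i, tameC (G i)) ->
  sphere_mean (fun x => \sum_(i <- r | P i) G i x) = \sum_(i <- r | P i) sphere_mean (G i).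
Proof.
move=> tG; elim: r => [|i r IH].
  rewrite big_nil; transitivity (sphere_mean (fun=> 0)).
    by apply: eq_sphere_mean => x _; rewrite big_nil.
  by have := sphere_meanZ 0 _ (tameC_cst 0); rewrite !mul0r.
rewrite big_cons -IH; case: ifP => Pi.
  rewrite -sphere_meanD//; last exact: tameC_sum.
  by apply: eq_sphere_mean => x _; rewrite big_cons Pi.
by apply: eq_sphere_mean => x _; rewrite big_cons Pi.
Qed.

Lemma sphere_mean1 : sphere_mean (fun=> 1) = 1.
Proof.
rewrite /sphere_mean !Rintegral_cst; try exact: measurable_sphere.
have -> : fine (omega (S : set (borel_space R d))) = 1.
  by rewrite [X in fine X](omega_inv.1).
by rewrite mul0r mul1r.
Qed.

Lemma sphere_mean_mulmx (h : 'M[R]_d) F : SO h -> tameC F ->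
  sphere_mean (fun x => F (h *m x)) = sphere_mean F.
Proof.
move=> hSO [F1 F2]; rewrite /sphere_mean; congr (_ +i* _).
  exact: (Rintegral_mulmx h _ hSO F1).
exact: (Rintegral_mulmx h _ hSO F2).
Qed.

End SphereMean.

(** * Plane rotations and charge conservation *)

Section PlaneRotation.
Variables (R : realType) (d : nat).
Notation vec := 'cV[R]_d.
Variables a b : vec.
Hypotheses (aa : dot a a = 1) (bb : dot b b = 1) (ab : dot a b = 0).

Lemma dotC (x y : vec) : dot x y = dot y x.
Proof. by apply: eq_bigr => i _; rewrite mulrC. Qed.

Lemma dotDl (x y z : vec) : dot (x + y) z = dot x z + dot y z.
Proof. by rewrite /dot -big_split/=; apply: eq_bigr => i _; rewrite mxE mulrDl. Qed.

Lemma dotZl c (x z : vec) : dot (c *: x) z = c * dot x z.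
Proof. by rewrite /dot mulr_sumr; apply: eq_bigr => i _; rewrite mxE mulrA. Qed.

Lemma dotNl (x z : vec) : dot (- x) z = - dot x z.
Proof. by rewrite -scaleN1r dotZl mulN1r. Qed.

Lemma outer_mul (x y z w : vec) :
  (x *m y^T) *m (z *m w^T) = dot y z *: (x *m w^T).
Proof.
by rewrite mulmxA -(mulmxA x) -dotE scalemxAl -mul_mx_scalar.
Qed.

Lemma outer_act (x y z : vec) : (x *m y^T) *m z = dot y z *: x.
Proof. by rewrite -mulmxA -dotE mul_mx_scalar. Qed.

(** Orthogonal projection onto the plane spanned by the orthonormal pair a, b,
    and the quarter turn a -> b -> -a of that plane. *)
Definition plane_proj := a *m a^T + b *m b^T.
Definition plane_turn := b *m a^T - a *m b^T.
Definition plane_rot (c s : R) : 'M[R]_d :=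
  1%:M + (c - 1) *: plane_proj + s *: plane_turn.

Lemma plane_projK : plane_proj *m plane_proj = plane_proj.
Proof.
rewrite /plane_proj mulmxDl !mulmxDr !outer_mul aa bb (dotC b a) ab.
by rewrite !scale0r !scale1r addr0 add0r.
Qed.

Lemma plane_turnK : plane_turn *m plane_turn = - plane_proj.
Proof.
rewrite /plane_turn mulmxBl !mulmxBr !outer_mul aa bb (dotC b a) ab.
by rewrite !scale0r !scale1r sub0r subr0 opprD addrC.
Qed.

Lemma plane_proj_turn : plane_proj *m plane_turn = plane_turn.
Proof.
rewrite /plane_turn /plane_proj mulmxDl !mulmxBr !outer_mul aa bb (dotC b a) ab.
by rewrite !scale0r !scale1r sub0r subr0 addrC.
Qed.

Lemma plane_turn_proj : plane_turn *m plane_proj = plane_turn.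
Proof.
rewrite /plane_turn /plane_proj mulmxBl !mulmxDr !outer_mul aa bb (dotC b a) ab.
by rewrite !scale0r !scale1r add0r addr0.
Qed.

Lemma plane_rotM c s c' s' :
  plane_rot c s *m plane_rot c' s' = plane_rot (c * c' - s * s') (c * s' + s * c').
Proof.
rewrite /plane_rot !mulmxDl !mulmxDr !mul1mx !mulmx1 -!scalemxAl -!scalemxAr.
rewrite plane_projK plane_turnK plane_proj_turn plane_turn_proj !scalerN !scalerA.
move: plane_proj plane_turn => P J.
apply/matrixP => i j; rewrite !mxE; ring.
Qed.

Lemma plane_rot_tr c s : (plane_rot c s)^T = plane_rot c (- s).
Proof.
have PT : plane_proj^T = plane_proj.
  by rewrite /plane_proj linearD/= !trmx_mul !trmxK.
have JT : plane_turn^T = - plane_turn.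
  by rewrite /plane_turn linearB/= !trmx_mul !trmxK opprB.
rewrite /plane_rot; move: plane_proj plane_turn PT JT => P J PT JT.
by rewrite !linearD/= !linearZ/= PT JT trmx1 scalerN scaleNr.
Qed.

Lemma plane_rot10 : plane_rot 1 0 = 1%:M.
Proof. by rewrite /plane_rot subrr !scale0r !addr0. Qed.

Lemma plane_rot_orthogonal t :
  plane_rot (cos t) (sin t) *m (plane_rot (cos t) (sin t))^T = 1%:M.
Proof.
rewrite plane_rot_tr plane_rotM mulrN opprK -!expr2 cos2Dsin2 mulrN mulrC addNr.
exact: plane_rot10.
Qed.

(** The rotation by t is the square of the rotation by t/2, and the determinant of
    an orthogonal matrix squares to 1. *)
Lemma plane_rot_SO t : SO (plane_rot (cos t) (sin t)).
Proof.
split; first exact: plane_rot_orthogonal.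
have tE : t = t / 2 + t / 2 by field.
rewrite tE cosD sinD (addrC (sin _ * _)) -plane_rotM det_mulmx.
by rewrite -{2}[plane_rot _ _]trmxK det_tr -det_mulmx plane_rot_orthogonal det1.
Qed.

Lemma dot_plane_rot c s (x u : vec) :
  dot (plane_rot c s *m x) u =
  dot x u + (c - 1) * (dot x a * dot a u + dot x b * dot b u)
    + s * (dot x a * dot b u - dot x b * dot a u).
Proof.
rewrite /plane_rot /plane_proj /plane_turn !mulmxDl mul1mx -!scalemxAl mulmxBl mulmxDl.
rewrite !outer_act !(dotDl, dotNl, dotZl) (dotC a x) (dotC b x).
ring.
Qed.

End PlaneRotation.

Section SphereMoments.
Variables (R : realType) (d : nat) (omega : probability (borel_space R d) R).
Hypothesis omega_inv : rotation_invariant omega.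
Notation vec := 'cV[R]_d.
Notation S := (@unit_sphere R d).
Notation mean := (sphere_mean R d omega).
Implicit Types (a b u w x : vec) (F G : vec -> R[i]) (c : R[i]).

(** The orthogonal projection of x onto the plane of a, b, as a complex number;
    rotating the plane by t multiplies it by exp(i t). *)
Definition plane_coord a b x : R[i] := dot x a +i* dot x b.

Lemma tameC_plane_coord a b : tameC R d (plane_coord a b).
Proof. by split; exact: tame_dot. Qed.

Lemma cis_expn (t : R) n : (cos t +i* sin t) ^+ n = cos (t *+ n) +i* sin (t *+ n) :> R[i].
Proof.
elim: n => [|n IH]; first by rewrite expr0 mulr0n cos0 sin0.
rewrite exprS IH mulrS cosD sinD -[LHS]/(_ +i* _) /=; congr (_ +i* _).
by rewrite addrC.
Qed.

(** The angle pi/(p-q) works for p > q; conjugation exchanges p and q. *)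
Lemma cis_weight p q : p != q -> exists t : R,
  (cos t +i* sin t) ^+ p * (((cos t +i* sin t))^*)%C ^+ q = -1 :> R[i].
Proof.
wlog pq : p q / (q < p)%N => [hw | _].
  move=> pq; case: (ltngtP q p) => [qp|pq'|e]; last by rewrite e eqxx in pq.
    exact: hw.
  have [|t ht] := hw q p pq'; first by rewrite eq_sym.
  exists t; have := congr1 (fun z => (z^*)%C) ht.
  rewrite rmorphM !rmorphXn/= opprK mulrC => ->.
  by apply/eqP; rewrite eq_complex /= !oppr0 !eqxx.
have k0 : (0 < p - q)%N by rewrite subn_gt0.
exists (pi / (p - q)%:R).
set e := (_ +i* _).
have ee : e * (e^*)%C = 1.
  rewrite /e -[LHS]/(_ +i* _) /= mulrN opprK -!expr2 cos2Dsin2.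
  by rewrite mulrN mulrC addNr.
rewrite -(subnK (ltnW pq)) exprD -mulrA -exprMn ee expr1n mulr1 cis_expn.
have -> : pi / (p - q)%:R *+ (p - q) = pi :> R.
  by rewrite -[LHS]mulr_natr divfK// pnatr_eq0 -lt0n.
rewrite cospi sinpi.
by apply/eqP; rewrite eq_complex /= oppr0 !eqxx.
Qed.

Lemma plane_coord_plane_rot a b t x : dot a a = 1 -> dot b b = 1 -> dot a b = 0 ->
  plane_coord a b (plane_rot R d a b (cos t) (sin t) *m x) =
    (cos t +i* sin t) * plane_coord a b x.
Proof.
move=> aa bb ab; rewrite /plane_coord !dot_plane_rot aa bb ab (dotC _ _ b a) ab.
by rewrite -[RHS]/(_ +i* _) /=; congr (_ +i* _); ring.
Qed.

(** Charge conservation: by [cis_weight] some rotation of the plane changes the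
    sign of the integrand, while it preserves the mean. *)
Lemma mean_charge a b p q F : dot a a = 1 -> dot b b = 1 -> dot a b = 0 ->
  tameC R d F ->
  (forall t x, F (plane_rot R d a b (cos t) (sin t) *m x) = F x) ->
  p != q -> mean (fun x => plane_coord a b x ^+ p * ((plane_coord a b x)^*)%C ^+ q * F x) = 0.
Proof.
move=> aa bb ab tF Finv pq; have [t ht] := cis_weight p q pq.
set G := (fun x => _).
have tG : tameC R d G.
  apply: tameCM => //; apply: tameCM; apply: tameCX; first exact: tameC_plane_coord.
  by apply: tameC_conj; exact: tameC_plane_coord.
have := sphere_mean_mulmx _ _ _ omega_inv _ _ (plane_rot_SO _ _ a b aa bb ab t) tG.
have -> : mean (fun x => G (plane_rot R d a b (cos t) (sin t) *m x)) =
    mean (fun x => -1 * G x).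
  apply: eq_sphere_mean => x _.
  rewrite /G Finv plane_coord_plane_rot// rmorphM/= !exprMn -ht.
  by ring.
rewrite sphere_meanZ// mulN1r => /eqP; rewrite eq_sym -addr_eq0 => /eqP h.
have : mean G *+ 2 == 0 by rewrite mulr2n h.
by rewrite mulrn_eq0 /= => /eqP.
Qed.

End SphereMoments.

(** * Highest weight vectors *)

Lemma conjcM (R : realType) (u v : R[i]) : ((u * v)^*)%C = (u^*)%C * (v^*)%C.
Proof. exact: rmorphM. Qed.

Lemma conjcD (R : realType) (u v : R[i]) : ((u + v)^*)%C = (u^*)%C + (v^*)%C.
Proof. exact: rmorphD. Qed.

Lemma conjcX (R : realType) (u : R[i]) n : ((u ^+ n)^*)%C = (u^*)%C ^+ n.
Proof. exact: rmorphXn. Qed.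

Lemma conjc_invol (R : realType) (u : R[i]) : (((u^*)%C)^*)%C = u.
Proof. by case: u => p q; rewrite /= opprK. Qed.

Lemma conjc_real (R : realType) (p : R) : ((p%:C)^*)%C = p%:C.
Proof. by rewrite /= oppr0. Qed.

Section HighestWeight.
Variables (R : realType) (d : nat) (omega : probability (borel_space R d) R).
Hypothesis omega_inv : rotation_invariant omega.
Notation vec := 'cV[R]_d.
Notation S := (@unit_sphere R d).
Notation mean := (sphere_mean R d omega).
Implicit Types (a b u w x : vec) (F G : vec -> R[i]) (c : R[i]).

(** The squared norm of the n-th power of the complex coordinate, a highest weight
    vector among the harmonics of degree n. *)
Definition power_norm a b n : R[i] :=
  mean (fun x => plane_coord R d a b x ^+ n * ((plane_coord R d a b x)^*)%C ^+ n).

Section Frame.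
Variables a b w : vec.
Hypotheses (aa : dot a a = 1) (bb : dot b b = 1) (ab : dot a b = 0).
Hypotheses (aw : dot a w = 0) (bw : dot b w = 0).
Local Notation z := (plane_coord R d a b).
Local Notation zc x := ((plane_coord R d a b x)^*)%C.

Let third x : R[i] := (dot x w)%:C.

Let tz : tameC R d z. Proof. exact: tameC_plane_coord. Qed.
Let tzc : tameC R d (fun x => zc x). Proof. exact: tameC_conj. Qed.
Let tthird : tameC R d third.
Proof. by apply: tameC_real; exact: tame_dot. Qed.

(** The complex coordinate of a rotated copy of the plane has this form, the third
    direction w being orthogonal to the original plane. *)
Definition weight_mix (al be ga : R[i]) x : R[i] := al * z x + be * zc x + ga * third x.

Lemma tameC_weight_mix al be ga : tameC R d (weight_mix al be ga).
Proof.
by apply: tameCD; [apply: tameCD|]; exact: tameCZ.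
Qed.

Let term (al be ga : R[i]) n p q k x :=
  weight_mix al be ga x ^+ n * z x ^+ p * zc x ^+ q * third x ^+ k.

Let tterm al be ga n p q k : tameC R d (term al be ga n p q k).
Proof.
apply: tameCM; last exact: tameCX.
apply: tameCM; last exact: tameCX.
apply: tameCM; last exact: tameCX.
apply: tameCX; exact: tameC_weight_mix.
Qed.

Let mean_termS al be ga n p q k :
  mean (term al be ga n.+1 p q k) =
    al * mean (term al be ga n p.+1 q k) + be * mean (term al be ga n p q.+1 k)
    + ga * mean (term al be ga n p q k.+1).
Proof.
have tZ c n' p' q' k' : tameC R d (fun x => c * term al be ga n' p' q' k' x).
  exact: tameCZ.
rewrite -!sphere_meanZ// -!sphere_meanD//; last exact: tameCD.
apply: eq_sphere_mean => x _; rewrite /term !exprS {1}/weight_mix.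
by move: (weight_mix _ _ _ _ ^+ n) (z x ^+ p) (zc x ^+ q) (third x ^+ k) => *; ring.
Qed.

Let mean_term0 al be ga p q k : p != q -> mean (term al be ga 0 p q k) = 0.
Proof.
move=> pq.
rewrite -(mean_charge _ _ _ omega_inv a b p q (fun x => third x ^+ k) aa bb ab _ _ pq).
- by apply: eq_sphere_mean => x _; rewrite /term expr0 mul1r.
- exact: tameCX.
- move=> t x; congr (_ ^+ k); rewrite /third dot_plane_rot aw bw.
  by rewrite !mulr0 subr0 addr0 !mulr0 !addr0.
Qed.

(** A factor [weight_mix] raises the charge by at most 1, so fewer than q - p of
    them cannot compensate the charge p - q. *)
Let mean_term_low al be ga n p q k : (n + p < q)%N -> mean (term al be ga n p q k) = 0.
Proof.
elim: n p q k => [|n IH] p q k h.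
  by apply: mean_term0; rewrite neq_ltn h.
rewrite mean_termS !IH ?mulr0 ?addr0//; lia.
Qed.

(** Here charge 0 is reached only by taking the term with coefficient al in every
    factor. *)
Let mean_term_top al be ga n p :
  mean (term al be ga n p (n + p) 0) = al ^+ n * power_norm a b (n + p).
Proof.
elim: n p => [|n IH] p.
  rewrite expr0 mul1r; apply: eq_sphere_mean => x _.
  by rewrite /term !expr0 mul1r mulr1.
rewrite mean_termS addSnnS IH !mean_term_low ?mulr0 ?addr0; try lia.
by rewrite exprS mulrA.
Qed.

Lemma mean_weight_mix_low al be ga n m : (n < m)%N ->
  mean (fun x => weight_mix al be ga x ^+ n * zc x ^+ m) = 0.
Proof.
move=> nm; rewrite -(@mean_term_low al be ga n 0 m 0) ?addn0//.
by apply: eq_sphere_mean => x _; rewrite /term !expr0 !mulr1.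
Qed.

Lemma mean_weight_mix_top al be ga n :
  mean (fun x => weight_mix al be ga x ^+ n * zc x ^+ n) = al ^+ n * power_norm a b n.
Proof.
rewrite -[in RHS](addn0 n) addn0 -[X in power_norm _ _ X](addn0 n) -(mean_term_top al be ga).
by apply: eq_sphere_mean => x _; rewrite /term !expr0 !mulr1 addn0.
Qed.

Lemma power_norm_conj n : ((power_norm a b n)^*)%C = power_norm a b n.
Proof.
rewrite -sphere_mean_conj; last by apply: tameCM; exact: tameCX.
by apply: eq_sphere_mean => x _; rewrite rmorphM !rmorphXn /= opprK mulrC.
Qed.

Lemma weight_mix_conj al be ga x :
  ((weight_mix al be ga x)^*)%C =
  weight_mix ((be^*)%C) ((al^*)%C) ((ga^*)%C) x.
Proof.
by rewrite /weight_mix !(conjcD, conjcM) conjc_invol conjc_real; ring.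
Qed.

Lemma Re_half (u : R[i]) : (complex.Re u)%:C = 2^-1 * (u + (u^*)%C).
Proof.
case: u => p q; apply/eqP; rewrite eq_complex /=.
apply/andP; split; apply/eqP; last by field.
by field.
Qed.

Let mean_real_parts F G : tameC R d F -> tameC R d G ->
  mean (fun x => 4^-1 * (F x + ((F x)^*)%C + (G x + ((G x)^*)%C))) =
  4^-1 * (mean F + ((mean F)^*)%C + (mean G + ((mean G)^*)%C)).
Proof.
move=> tF tG; have tF' := tameC_conj _ _ _ tF; have tG' := tameC_conj _ _ _ tG.
have tFF := tameCD _ _ _ _ tF tF'; have tGG := tameCD _ _ _ _ tG tG'.
rewrite -!sphere_mean_conj// -!sphere_meanD// -sphere_meanZ//.
exact: tameCD.
Qed.

(** Multiplying out the two real parts leaves four means, two of them conjugate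
    to the other two. *)
Let mean_split al be ga n m (W := weight_mix al be ga) :
  mean (fun x => (complex.Re (W x ^+ n))%:C * (complex.Re (z x ^+ m))%:C) =
  4^-1 * (mean (fun x => W x ^+ n * zc x ^+ m)
   + ((mean (fun x => W x ^+ n * zc x ^+ m))^*)%C
   + (mean (fun x => ((W x)^*)%C ^+ n * zc x ^+ m)
   + ((mean (fun x => ((W x)^*)%C ^+ n * zc x ^+ m))^*)%C)).
Proof.
have tW : tameC R d W by exact: tameC_weight_mix.
have t1 : tameC R d (fun x => W x ^+ n * zc x ^+ m) by apply: tameCM; exact: tameCX.
have t2 : tameC R d (fun x => ((W x)^*)%C ^+ n * zc x ^+ m).
  by apply: tameCM; apply: tameCX => //; exact: tameC_conj.
rewrite -(mean_real_parts _ _ t1 t2).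
apply: eq_sphere_mean => x _.
rewrite !Re_half !(conjcM, conjcX, conjc_invol).
move: (W x ^+ n) (z x ^+ m) (zc x ^+ m) (((W x)^*)%C ^+ n) => p r s t.
by field.
Qed.

Lemma mean_Re_lt (al be : R) ga n m : (n < m)%N ->
  let W := weight_mix al%:C be%:C ga in
  mean (fun x => (complex.Re (W x ^+ n))%:C * (complex.Re (z x ^+ m))%:C) = 0.
Proof.
move=> nm W; rewrite mean_split mean_weight_mix_low//.
have -> : mean (fun x => ((W x)^*)%C ^+ n * zc x ^+ m) = 0.
  rewrite -(mean_weight_mix_low be%:C al%:C (ga^*)%C n m nm).
  by apply: eq_sphere_mean => x _; rewrite weight_mix_conj !conjc_real.
by rewrite -[0^*%C]/((0%:C)^*)%C conjc_real !addr0 mulr0.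
Qed.

(** The coefficients al and be come from the products of opposite and of equal
    charge respectively. *)
Lemma mean_Re_eq (al be : R) ga n :
  let W := weight_mix al%:C be%:C ga in
  mean (fun x => (complex.Re (W x ^+ n))%:C * (complex.Re (z x ^+ n))%:C) =
  2^-1 * (al ^+ n + be ^+ n)%:C * power_norm a b n.
Proof.
move=> W; rewrite mean_split mean_weight_mix_top.
have -> : mean (fun x => ((W x)^*)%C ^+ n * zc x ^+ n) = be%:C ^+ n * power_norm a b n.
  rewrite -(mean_weight_mix_top be%:C al%:C (ga^*)%C n).
  by apply: eq_sphere_mean => x _; rewrite weight_mix_conj !conjc_real.
rewrite !conjcM !conjcX !conjc_real power_norm_conj rmorphD !rmorphXn /=.
by field.
Qed.

(** The coordinate along a is half the sum of z and its conjugate; in the binomial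
    expansion of its power only the central term has charge 0. *)
Lemma mean_axis_power n l :
  4 ^+ n * mean (fun x => (dot x a)%:C ^+ n.*2 * (z x * zc x) ^+ l) =
  'C(n.*2, n)%:R * power_norm a b (n + l).
Proof.
rewrite -sphere_meanZ; last first.
  apply: tameCM; apply: tameCX; last exact: tameCM.
  by apply: tameC_real; exact: tame_dot.
transitivity (mean (fun x => \sum_(i < n.*2.+1) 'C(n.*2, i)%:R *
   (z x ^+ (n.*2 - i + l) * zc x ^+ (i + l) * 1))).
  apply: eq_sphere_mean => x _.
  have -> : (dot x a)%:C = 2^-1 * (z x + zc x) by rewrite -Re_half.
  have -> : 4 ^+ n * ((2^-1 * (z x + zc x)) ^+ n.*2 * (z x * zc x) ^+ l)
     = (z x + zc x) ^+ n.*2 * (z x * zc x) ^+ l.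
    rewrite mulrA; congr (_ * _).
    rewrite (exprMn n.*2) mulrA -[in 2^-1 ^+ _]muln2 mulnC (exprM 2^-1) -(exprMn n).
    by rewrite (_ : 4 * 2^-1 ^+ 2 = 1) ?expr1n ?mul1r// ; field.
  rewrite exprDn mulr_suml; apply: eq_bigr => i _.
  by rewrite -mulr_natl exprMn !exprD; ring.
have tterms i : tameC R d (fun x => z x ^+ (n.*2 - i + l) * zc x ^+ (i + l) * 1).
  by apply: tameCM; [apply: tameCM; exact: tameCX|exact: tameC_cst].
rewrite sphere_mean_sum; last by move=> i; exact: tameCZ.
have nn : (n < n.*2.+1)%N by lia.
rewrite (bigD1 (Ordinal nn))//= big1 ?addr0 => [|i].
  rewrite sphere_meanZ//.
  congr (_ * _); apply: eq_sphere_mean => x _; rewrite mulr1.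
  by rewrite (_ : n.*2 - n = n)%N//; lia.
rewrite -val_eqE /= => ni.
rewrite sphere_meanZ//.
rewrite (mean_charge _ _ _ omega_inv a b _ _ (fun=> 1) aa bb ab) ?mulr0//.
  exact: tameC_cst.
by have := ltn_ord i; lia.
Qed.

End Frame.
End HighestWeight.

(** * Norms of the highest weight vectors *)

Section PowerNorm.
Variables (R : realType) (d : nat) (omega : probability (borel_space R d) R).
Hypothesis omega_inv : rotation_invariant omega.
Notation vec := 'cV[R]_d.
Notation S := (@unit_sphere R d).
Notation mean := (sphere_mean R d omega).
Notation zeta := (plane_coord R d).
Notation N := (power_norm R d omega).

Definition axis (i : 'I_d) : vec := basis_vec R d i.+1.

Lemma dot_axis (x : vec) i : dot x (axis i) = x i 0.
Proof.
rewrite /dot (bigD1 i)//= !mxE eqxx mulr1 big1 ?addr0// => k ki.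
by rewrite !mxE eqSS val_eqE (negbTE ki) mulr0.
Qed.

Lemma dot_axis_axis i j : dot (axis i) (axis j) = (i == j)%:R.
Proof. by rewrite dot_axis !mxE eqSS val_eqE eq_sym. Qed.

Definition axis_moment i n := mean (fun x => (x i 0)%:C ^+ n.*2).

Lemma central_binS n :
  n.+1%:R * 'C(n.+1.*2, n.+1)%:R = 2 * (n.*2.+1)%:R * 'C(n.*2, n)%:R :> R[i].
Proof.
rewrite -!natrM; congr _%:R.
have h1 := mul_bin_diag n.*2.+2 n; have h2 := mul_bin_down n.*2.+1 n.
rewrite /= in h1 h2; rewrite doubleS -h1.
have -> : (n.*2.+2 = 2 * n.+1)%N by lia.
rewrite -!mulnA h2; congr (_ * (_ * _))%N; lia.
Qed.

Lemma axis_power_norm i j n : i != j ->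
  4 ^+ n * axis_moment i n = 'C(n.*2, n)%:R * N (axis i) (axis j) n.
Proof.
move=> ij; rewrite -[X in N _ _ X]addn0.
rewrite -(mean_axis_power _ _ _ omega_inv (axis i) (axis j));
  rewrite ?dot_axis_axis ?eqxx ?(negbTE ij)//.
by congr (_ * _); apply: eq_sphere_mean => x _; rewrite expr0 mulr1 dot_axis.
Qed.

Lemma tameC_coordX i n : tameC R d (fun x => (x i 0)%:C ^+ n).
Proof. by apply: tameCX; apply: tameC_real; exact: tame_coord. Qed.

(** On the plane of the two axes x_i^2 + x_j^2 is the squared modulus of the complex
    coordinate, so [mean_axis_power] gives the mean of
    x_i^(2n) (x_i^2 + x_j^2) as well as that of x_i^(2n+2). *)
Lemma axis_cross_moment i j n : i != j ->
  n.*2.+1%:R * mean (fun x => (x i 0)%:C ^+ n.*2 * (x j 0)%:C ^+ 2) = axis_moment i n.+1.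
Proof.
move=> ij.
have E1 := mean_axis_power _ _ _ omega_inv (axis i) (axis j) _ _ _ n 1.
rewrite !dot_axis_axis !eqxx (negbTE ij) in E1.
have {}E1 := E1 erefl erefl erefl.
have E2 := axis_power_norm i j n.+1 ij.
have E3 := central_binS n.
rewrite addn1 in E1.
have E4 : mean (fun x => (dot x (axis i))%:C ^+ n.*2 *
     (zeta (axis i) (axis j) x * ((zeta (axis i) (axis j) x)^*)%C) ^+ 1)
   = axis_moment i n.+1 + mean (fun x => (x i 0)%:C ^+ n.*2 * (x j 0)%:C ^+ 2).
  rewrite /axis_moment -sphere_meanD; last 2 first.
  - exact: tameC_coordX.
  - by apply: tameCM; exact: tameC_coordX.
  apply: eq_sphere_mean => x _.
  rewrite !dot_axis /plane_coord !dot_axis expr1 doubleS -addn2 exprD.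
  rewrite -mulrDr; congr (_ * _); apply/eqP; rewrite eq_complex !expr2 /=.
  by apply/andP; split; apply/eqP; ring.
rewrite E4 in E1.
move: (mean _) E1 {E4} => M E1.
move: (axis_moment i n.+1) (N _ _ _) E1 E2 => G P E1 E2.
have n0 : n.+1%:R != 0 :> R[i] by rewrite pnatr_eq0.
have q0 : 4 ^+ n != 0 :> R[i] by rewrite expf_neq0// pnatr_eq0.
have oE : n.*2.+1%:R = 2 * n.+1%:R - 1 :> R[i].
  by rewrite -(natr1 n.*2) -(natr1 n) -muln2 natrM; ring.
rewrite exprS oE in E2 E3 *.
move: (n.+1%:R : R[i]) (4 ^+ n : R[i]) ('C(n.*2, n)%:R : R[i]) ('C(n.+1.*2, n.+1)%:R : R[i])
  n0 q0 E1 E2 E3 => k q C C' k0 q0 E1 E2 E3.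
apply: (mulfI (mulf_neq0 q0 k0)).
transitivity (k * ((2 * k - 1) * (q * (G + M) - q * G))); first by ring.
rewrite E1 (_ : k * _ = 2^-1 * (k * (2 * (2 * k - 1) * C * P))
  - k * (2 * k - 1) * q * G); last by field.
by rewrite -E3 -mulrA -E2; field.
Qed.

(** Insert 1 = sum of the x_k^2 under the integral. *)
Lemma axis_moment_rec i n :
  n.*2.+1%:R * axis_moment i n = (n.*2 + d)%:R * axis_moment i n.+1.
Proof.
transitivity (mean (fun x => \sum_k n.*2.+1%:R * ((x i 0)%:C ^+ n.*2 * (x k 0)%:C ^+ 2))).
  rewrite -sphere_meanZ; last exact: tameC_coordX.
  apply: eq_sphere_mean => x Sx; rewrite -!mulr_sumr.
  have -> : \sum_k (x k 0)%:C ^+ 2 = 1 :> R[i].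
    rewrite -[1]/(1%:C) -[in RHS]Sx /dot rmorph_sum; apply: eq_bigr => k _.
    by rewrite rmorphM expr2.
  by rewrite mulr1.
rewrite sphere_mean_sum; last first.
  by move=> k; apply: tameCZ; apply: tameCM; exact: tameC_coordX.
have tt k : tameC R d (fun x => (x i 0)%:C ^+ n.*2 * (x k 0)%:C ^+ 2).
  by apply: tameCM; exact: tameC_coordX.
rewrite (bigD1 i)//= (eq_bigr (fun=> axis_moment i n.+1)); last first.
  by move=> k ki; rewrite sphere_meanZ// axis_cross_moment// eq_sym.
have -> : mean (fun x => n.*2.+1%:R * ((x i 0)%:C ^+ n.*2 * (x i 0)%:C ^+ 2))
   = n.*2.+1%:R * axis_moment i n.+1.
  rewrite sphere_meanZ//; congr (_ * _); apply: eq_sphere_mean => x _.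
  by rewrite -exprD addn2.
rewrite sumr_const -[X in _ + X]mulr_natl -mulrDl; congr (_ * _).
have -> : #|(fun j : 'I_d => j != i)| = d.-1.
  have := cardC1 i; rewrite card_ord => <-; apply: eq_card => k.
  by rewrite !inE.
rewrite -natrD; congr _%:R; have := ltn_ord i; lia.
Qed.

Lemma axis_moment0 i : axis_moment i 0 = 1.
Proof.
rewrite -(sphere_mean1 _ _ _ omega_inv).
by apply: eq_sphere_mean => x _; rewrite expr0.
Qed.

Lemma power_norm_rec i j n : i != j ->
  (n.*2 + d)%:R * N (axis i) (axis j) n.+1 = n.+1.*2%:R * N (axis i) (axis j) n.
Proof.
move=> ij.
have E1 := axis_power_norm i j n ij; have E2 := axis_power_norm i j n.+1 ij.
have E3 := central_binS n; have E4 := axis_moment_rec i n.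
move: (axis_moment i n) (axis_moment i n.+1) (N _ _ n) (N _ _ n.+1) E1 E2 E4
  => G G' P P' E1 E2 E4.
have C0 : 'C(n.*2, n)%:R != 0 :> R[i] by rewrite pnatr_eq0 -lt0n bin_gt0; lia.
have o0 : n.*2.+1%:R != 0 :> R[i] by rewrite pnatr_eq0.
have t0 : 2 != 0 :> R[i] by rewrite pnatr_eq0.
apply: (mulfI (mulf_neq0 (mulf_neq0 t0 C0) o0)).
transitivity ((n.*2 + d)%:R * (2 * n.*2.+1%:R * 'C(n.*2, n)%:R) * P'); first by ring.
rewrite -E3 (_ : _ * P' = n.+1%:R * (n.*2 + d)%:R * ('C(n.+1.*2, n.+1)%:R * P'));
  last by ring.
rewrite -E2 exprS (_ : _ * (_ * G') = 4 * 4 ^+ n * n.+1%:R * ((n.*2 + d)%:R * G'));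
  last by ring.
rewrite -E4 (_ : _ * (_ * G) = 4 * n.+1%:R * n.*2.+1%:R * (4 ^+ n * G)); last by ring.
by rewrite E1 -(muln2 n.+1) natrM; ring.
Qed.

Lemma power_normE i j n : i != j ->
  N (axis i) (axis j) n = (n`!%:R / rising R (d%:R / 2) n)%:C.
Proof.
move=> ij.
have d0 : 0 < d%:R :> R by rewrite ltr0n (leq_ltn_trans _ (ltn_ord i)).
elim: n => [|n IH].
  have := axis_power_norm i j 0 ij.
  rewrite expr0 axis_moment0 bin0 !mul1r /rising big_ord0 => <-.
  by rewrite invr1.
have nd : (n.*2 + d)%:R != 0 :> R[i].
  by rewrite pnatr_eq0 -lt0n (leq_trans _ (leq_addl _ _))// (leq_ltn_trans _ (ltn_ord i)).
apply: (mulfI nd); rewrite power_norm_rec// IH risingS factS.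
have -> : (n.*2 + d)%:R = ((n.*2 + d)%:R : R)%:C by rewrite rmorph_nat.
have -> : n.+1.*2%:R = (n.+1.*2%:R : R)%:C by rewrite rmorph_nat.
rewrite -!rmorphM; congr (_%:C).
have r0 : rising R (d%:R / 2) n != 0.
  by rewrite lt0r_neq0// prodr_gt0// => k _; rewrite ltr_wpDr// divr_gt0.
have s0 : d%:R / 2 + n%:R != 0 :> R by rewrite lt0r_neq0// ltr_wpDr// divr_gt0.
rewrite -(muln2 n.+1) !natrM natrD -muln2 natrM.
have -> : n%:R * 2 + d%:R = 2 * (d%:R / 2 + n%:R) :> R by field.
move: (d%:R / 2 + n%:R) s0 (rising _ _ _) r0 => s s0 r r0.
by field; rewrite r0 s0.
Qed.

End PowerNorm.

(** * Correlation of rotated highest weight vectors *)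

Lemma limn_series_fin (R : realType) (u : nat -> R) N :
  (forall n, (N <= n)%N -> u n = 0) -> limn (series u) = \sum_(n < N) u n.
Proof.
move=> u0; apply: cvg_lim => //; apply: cvg_near_cst; exists N => // n /= Nn.
rewrite /series /= (big_cat_nat (n := N))//= [X in _ + X]big1_seq ?addr0 ?big_mkord// => k.
by rewrite mem_index_iota => /andP[_ /andP[Nk _]]; exact: u0.
Qed.

Section Correlation.
Variables (R : realType) (d : nat) (omega : probability (borel_space R d) R).
Hypothesis omega_inv : rotation_invariant omega.
Hypothesis d2 : (2 <= d)%N.
Notation vec := 'cV[R]_d.
Notation S := (@unit_sphere R d).
Notation mean := (sphere_mean R d omega).
Let a : vec := basis_vec R d d.
Let b : vec := basis_vec R d d.-1.
Notation z := (plane_coord R d a b).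

Let lt1 : (d.-1 < d)%N. Proof. by lia. Qed.
Let lt2 : (d.-2 < d)%N. Proof. by lia. Qed.
Let i1 : 'I_d := Ordinal lt1.
Let i2 : 'I_d := Ordinal lt2.
Let aE : a = axis R d i1.
Proof. by rewrite /a /axis /= prednK//; lia. Qed.
Let bE : b = axis R d i2.
Proof. by rewrite /b /axis /=; congr basis_vec; lia. Qed.
Let i12 : i1 != i2.
Proof. by rewrite -val_eqE /=; lia. Qed.

Let aa : dot a a = 1. Proof. by rewrite aE dot_axis_axis eqxx. Qed.
Let bb : dot b b = 1. Proof. by rewrite bE dot_axis_axis eqxx. Qed.
Let ab : dot a b = 0. Proof. by rewrite aE bE dot_axis_axis (negbTE i12). Qed.

(** The rotation h fixes a and sends b to t b + w with w orthogonal to a and b. *)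
Lemma plane_coord_rotate h x (t := dot (h *m b) b) : SO h -> h *m a = a ->
  z (invmx h *m x) =
  weight_mix R d a b (h *m b - t *: b) (((1 + t) / 2)%:C) (((1 - t) / 2)%:C) 'i x.
Proof.
move=> hSO ha; have [hu hT [_ _]] := SO_invmx _ _ h hSO.
have dh u : dot (invmx h *m x) u = dot x (h *m u).
  by rewrite dot_mulmx hT trmxK.
rewrite /plane_coord !dh ha /weight_mix.
have -> : dot x (h *m b) = t * dot x b + dot x (h *m b - t *: b).
  by rewrite !(dotC _ _ x) dotDl dotNl dotZl; ring.
move: (h *m b - t *: b) => w.
by apply/eqP; rewrite eq_complex /=; apply/andP; split; apply/eqP; field.
Qed.

Lemma correlation_le h n m (t := dot (h *m b) b) : SO h -> h *m a = a -> (n <= m)%N ->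
  mean (fun x => (complex.Re (z (invmx h *m x) ^+ n))%:C * (complex.Re (z x ^+ m))%:C) =
  if n == m
  then 2^-1 * (((1 + t) / 2) ^+ n + ((1 - t) / 2) ^+ n)%:C * power_norm R d omega a b n
  else 0.
Proof.
move=> hSO ha nm.
pose w := h *m b - t *: b.
have hab : dot a (h *m b) = 0.
  have [hu hT _] := SO_invmx _ _ h hSO.
  by rewrite -{1}ha dot_mulmx -hT mulKmx.
have aw : dot a w = 0.
  by rewrite dotC dotDl dotNl dotZl !(dotC _ _ _ a) hab ab mulr0 subr0.
have bw : dot b w = 0.
  by rewrite dotC dotDl dotNl dotZl bb mulr1 subrr.
transitivity (mean (fun x => (complex.Re (weight_mix R d a b w
    (((1 + t) / 2)%:C) (((1 - t) / 2)%:C) 'i x ^+ n))%:C *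
    (complex.Re (z x ^+ m))%:C)).
  by apply: eq_sphere_mean => x _; rewrite plane_coord_rotate.
case: eqP => [<-|/eqP nm'].
  by rewrite (mean_Re_eq _ _ _ omega_inv _ _ _ aa bb ab aw bw).
by rewrite (mean_Re_lt _ _ _ omega_inv _ _ _ aa bb ab aw bw)// ltn_neqAle nm'.
Qed.

(** For n > m, move h to the other factor by invariance. *)
Lemma correlation h n m (t := dot (h *m b) b) : SO h -> h *m a = a ->
  mean (fun x => (complex.Re (z (invmx h *m x) ^+ n))%:C * (complex.Re (z x ^+ m))%:C) =
  if n == m
  then 2^-1 * (((1 + t) / 2) ^+ n + ((1 - t) / 2) ^+ n)%:C * power_norm R d omega a b n
  else 0.
Proof.
move=> hSO ha; have [nm|mn] := leqP n m; first exact: correlation_le.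
rewrite gtn_eqF//.
have [hu hT hiSO] := SO_invmx _ _ h hSO.
have hia : invmx h *m a = a by rewrite -{1}ha mulKmx.
have := correlation_le (invmx h) m n hiSO hia (ltnW mn).
rewrite ltn_eqF// invmxK => <-.
have tz n' : tameC R d (fun x => (complex.Re (z x ^+ n'))%:C).
  by apply: tameC_real; have [] := tameCX _ _ _ n' (tameC_plane_coord _ _ a b).
have tzh n' (g : 'M[R]_d) : SO g -> tameC R d (fun x => (complex.Re (z (g *m x) ^+ n'))%:C).
  by move=> gSO; exact: tameC_mulmx (tz n').
rewrite -(sphere_mean_mulmx _ _ _ omega_inv h _ hSO); last first.
  by apply: tameCM; [exact: tzh|exact: tz].
by apply: eq_sphere_mean => x _; rewrite mulKmx// mulrC.
Qed.

(** The constants A_(n,...,n) normalise the highest weight vectors. *)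
Lemma power_norm_Acoef n : (3 <= d)%N ->
  (Acoef R d n (nseq (d - 2) n%:Z) ^+ 2)%:C * power_norm R d omega a b n = 1.
Proof.
move=> d3; rewrite aE bE power_normE// Acoef_nseq_sqr// half_gamma_rising; last lia.
have hd := lt0r_neq0 (half_gamma_gt0 R d (ltnW (ltnW d3))).
have n0 : n`!%:R != 0 :> R by rewrite pnatr_eq0 -lt0n fact_gt0.
have r0 : rising R (d%:R / 2) n != 0.
  rewrite lt0r_neq0// prodr_gt0// => k _; rewrite ltr_wpDr// divr_gt0// ltr0n; lia.
rewrite -rmorphM -[RHS](rmorph1 (real_complex R)); congr (_%:C).
move: (rising _ _ _) r0 (half_gamma _ _) hd (n`!%:R) n0 => r r0 g g0 f f0.
by field; rewrite r0 g0 f0.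
Qed.

End Correlation.

(** * The curvelets *)

Section CurveletAutocorrelation.
Variables (R : realType) (q : nat) (phi : R -> R) (j : nat).
Hypotheses (hphi : curvelet_cutoff q phi) (hj : (1 <= j)%N).
Let K n := kappa phi (n%:R / 2 ^+ j.-1).

Lemma kappa_cutoff n : (2 ^ j <= n)%N -> K n = 0.
Proof.
move=> jn; apply: (kappa_eq0 hphi).
rewrite ler_pdivlMr ?exprn_gt0// -natrX -natrM ler_nat.
by rewrite -expnS prednK.
Qed.

Lemma curveletE d (x : 'cV[R]_d) :
  curvelet phi j x = (Num.sqrt 2 * \sum_(n < 2 ^ j)
    Num.sqrt (dimH R d n) * K n * Acoef R d n (nseq (d - 2) n%:Z) *
      complex.Re (plane_coord R d (basis_vec R d d) (basis_vec R d d.-1) x ^+ n))%:C.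
Proof.
rewrite /curvelet (limn_series_fin _ _ (2 ^ j)%N)// => n jn.
by rewrite -/(K n) kappa_cutoff// mulr0 !mul0r.
Qed.

Lemma dimH_ge0 d n : 0 <= dimH R d n.
Proof. by rewrite /dimH divr_ge0. Qed.

(** Off-diagonal pairs of degrees do not correlate, and on the diagonal the
    normalisation constant cancels the norm of the highest weight vector. *)
Lemma curvelet_autocorrelation d (omega : probability (borel_space R d) R) (h : 'M[R]_d)
    (t := dot (h *m basis_vec R d d.-1) (basis_vec R d d.-1)) :
  (3 <= d)%N -> rotation_invariant omega -> SO h ->
  h *m basis_vec R d d = basis_vec R d d ->
  inner omega (rotate h (@curvelet R d phi j)) (@curvelet R d phi j) =
  (\sum_(n < 2 ^ j) dimH R d n * K n ^+ 2 *
     (((1 + t) / 2) ^+ n + ((1 - t) / 2) ^+ n))%:C.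
Proof.
move=> d3 om hSO ha.
set a := basis_vec R d d; set b := basis_vec R d d.-1.
pose z := plane_coord R d a b.
pose s n := Num.sqrt (dimH R d n) * K n * Acoef R d n (nseq (d - 2) n%:Z).
pose cc n m x := (complex.Re (z (invmx h *m x) ^+ n))%:C * (complex.Re (z x ^+ m))%:C.
have tz n' : tameC R d (fun x => (complex.Re (z x ^+ n'))%:C).
  by apply: tameC_real; have [] := tameCX _ _ _ n' (tameC_plane_coord _ _ a b).
have [_ _ hiSO] := SO_invmx _ _ h hSO.
have tcc n m : tameC R d (cc n m).
  by apply: tameCM; [exact: tameC_mulmx hiSO (tz n)|exact: tz].
have cE x : curvelet phi j x =
    (Num.sqrt 2 * \sum_(n < 2 ^ j) s n * complex.Re (z x ^+ n))%:C.
  exact: curveletE.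
rewrite innerE.
transitivity (sphere_mean R d omega (fun x => \sum_(n < 2 ^ j) \sum_(m < 2 ^ j)
   (2 * s n * s m)%:C * cc n m x)).
  apply: eq_sphere_mean => x _.
  rewrite /rotate !cE conjc_real -rmorphM.
  rewrite mulrACA -expr2 sqr_sqrtr// mulr_suml mulr_sumr rmorph_sum/=.
  apply: eq_bigr => n _; rewrite mulr_sumr mulr_sumr rmorph_sum/=.
  apply: eq_bigr => m _; rewrite /cc -!rmorphM; congr (_%:C).
  by move: (complex.Re _) (complex.Re _) (s n) (s m) => *; ring.
rewrite sphere_mean_sum; last by move=> n; apply: tameC_sum => m; exact: tameCZ.
rewrite rmorph_sum; apply: eq_bigr => n _.
rewrite sphere_mean_sum; last by move=> m; exact: tameCZ.
rewrite (bigD1 n)//= big1 ?addr0 => [|m mn]; last first.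
  rewrite sphere_meanZ// (correlation _ _ _ om _ h _ _ hSO ha); last by lia.
  by rewrite -val_eqE eq_sym in mn; rewrite (negbTE mn) mulr0.
rewrite sphere_meanZ// (correlation _ _ _ om _ h _ _ hSO ha) ?eqxx; last by lia.
have E := power_norm_Acoef _ _ omega om (ltnW d3) n d3.
rewrite -/a -/b -/t in E *; move: (_ + _) => u.
have sE : s n ^+ 2 = dimH R d n * K n ^+ 2 * Acoef R d n (nseq (d - 2) n%:Z) ^+ 2.
  by rewrite /s !exprMn sqr_sqrtr// dimH_ge0.
rewrite -mulrA -expr2 sE; move: (Acoef _ _ _ _ ^+ 2) (power_norm _ _ _ _ _ _) E => A2 P E.
have E2 : (2 : R)%:C = 2 :> R[i] by rewrite -(rmorph_nat (real_complex R)).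
have cM (p r : R) : (p * r)%:C = p%:C * r%:C by exact: rmorphM.
move: (dimH R d n) (K n ^+ 2) => D k; rewrite !cM E2.
transitivity (D%:C * k%:C * u%:C * (A2%:C * P)); first by field.
by rewrite E mulr1.
Qed.

End CurveletAutocorrelation.

Section Rotation12.
Variable R : realType.

Lemma rotation12_plane (g : R) :
  rotation12 g = plane_rot R 3 (basis_vec R 3 1) (basis_vec R 3 2) (cos g) (sin g).
Proof.
apply/matrixP => i j; rewrite !mxE !big_ord1 !mxE.
by case: i => [[|[|[|?]]] ?] //; case: j => [[|[|[|?]]] ?] //=; ring.
Qed.

Lemma rotation12_SO (g : R) : SO (rotation12 g).
Proof.
rewrite rotation12_plane; apply: plane_rot_SO;
  by rewrite /dot !big_ord_recl big_ord0 !mxE /=; ring.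
Qed.

Lemma rotation12_basis3 (g : R) : rotation12 g *m basis_vec R 3 3 = basis_vec R 3 3.
Proof.
apply/matrixP => i j; rewrite !mxE !big_ord_recl big_ord0 !mxE /=.
by case: i => [[|[|[|?]]] ?] //=; ring.
Qed.

Lemma rotation12_basis2 (g : R) :
  dot (rotation12 g *m basis_vec R 3 2) (basis_vec R 3 2) = cos g.
Proof.
rewrite /dot !big_ord_recl big_ord0 !mxE !big_ord_recl !big_ord0 !mxE /=.
ring.
Qed.

End Rotation12.

Theorem proposition5p1 (R : realType) (q : nat) (hq : (1 <= q)%N)
    (phi : R -> R) (hphi : curvelet_cutoff q phi) (j : nat) (hj : (1 <= j)%N) :
  (forall (omega : probability (borel_space R 3) R),
     rotation_invariant omega ->
     forall gamma : R, 0 <= gamma -> gamma < 2 * pi ->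
       inner omega
         (rotate (rotation12 gamma) (@curvelet R 3 phi j)) (@curvelet R 3 phi j)
       = (limn (series (fun n : nat =>
             dimH R 3 n * `|kappa phi (n%:R / 2 ^+ j.-1)| ^+ 2 *
             (cos (gamma / 2) ^+ (2 * n) + sin (gamma / 2) ^+ (2 * n)))))%:C)
  /\
  (forall d : nat, (4 <= d)%N ->
   forall (omega : probability (borel_space R d) R),
     rotation_invariant omega ->
     forall h : 'M[R]_d, @SO R d h ->
       h *m basis_vec R d d = basis_vec R d d ->
       inner omega
         (rotate h (@curvelet R d phi j)) (@curvelet R d phi j)
       = (2 * limn (series (fun n : nat =>
             dimH R d n * `|kappa phi (n%:R / 2 ^+ j.-1)| ^+ 2 *
             \sum_(0 <= m < n.+1 | ~~ odd m)
               (Normc.normc (ccoef R d n m) ^+ 2 *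
                (Gamma (d - 3)%:R * m`!%:R / Gamma (m + d - 3)%:R) *
                gegenbauer ((d - 3)%:R / 2) m
                  (dot (h *m basis_vec R d d.-1) (basis_vec R d d.-1))))))%:C).
Proof.
have k0 n : (2 ^ j <= n)%N -> kappa phi (n%:R / 2 ^+ j.-1) = 0.
  exact: (kappa_cutoff R q).
have kN n : `|kappa phi (n%:R / 2 ^+ j.-1)| ^+ 2 = kappa phi (n%:R / 2 ^+ j.-1) ^+ 2.
  by rewrite real_normK ?num_real.
split=> [omega om g _ _|d d4 omega om h hSO ha].
- rewrite (curvelet_autocorrelation R q phi j hphi hj 3 omega)//; last 2 first.
  + exact: rotation12_SO.
  + exact: rotation12_basis3.
  congr (_%:C); rewrite (limn_series_fin _ _ (2 ^ j)%N) => [|n jn]; last first.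
    by rewrite k0// normr0 expr0n mulr0 mul0r.
  apply: eq_bigr => n _; rewrite kN rotation12_basis2; congr (_ * _).
  (* t = cos g, so (1+t)/2 and (1-t)/2 are the squares at the half angle. *)
  have gE : cos g = cos (g / 2) ^+ 2 - sin (g / 2) ^+ 2.
    by rewrite -[in LHS](_ : g / 2 + g / 2 = g) ?cosD ?expr2//; field.
  have := cos2Dsin2 (g / 2); move: (cos (g / 2)) (sin (g / 2)) gE => c s -> cs.
  have -> : s ^+ 2 = 1 - c ^+ 2 by rewrite -cs addrAC subrr add0r.
  have cE : (1 + (c ^+ 2 - (1 - c ^+ 2))) / 2 = c ^+ 2 by field.
  have sE : (1 - (c ^+ 2 - (1 - c ^+ 2))) / 2 = s ^+ 2.
    by rewrite (_ : s ^+ 2 = 1 - c ^+ 2); [field|rewrite -cs addrAC subrr add0r].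
  by rewrite cE sE -!exprM.
rewrite (curvelet_autocorrelation R q phi j hphi hj d omega)//; last exact: ltnW.
congr (_%:C); rewrite (limn_series_fin _ _ (2 ^ j)%N) => [|n jn]; last first.
  by rewrite k0// normr0 expr0n mulr0 mul0r.
rewrite mulr_sumr; apply: eq_bigr => n _.
rewrite kN [RHS]mulrCA; congr (_ * _).
rewrite (gegenbauer_even_expansion R (d - 4)); congr (2 * _).
rewrite !big_mkord; apply: eq_bigr => m _.
rewrite weight_ccoef//; last by rewrite -ltnS.
by rewrite (_ : ((d - 4).+1 = d - 3)%N)//; lia.
Qed.
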